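(* Let $d\ge1$ and let $(A_n,B_n)_{n\ge1}$ be i.i.d. random variables with values in $\mathcal M(d,\mathbb R)\times\mathbb R^d$, with $\mathbb E(\ln^+\|A_1\|)<+\infty$ and Lyapunov exponent $\gamma_{\bar\mu}=0$. Let $\nu$ be a $\bar\mu$-invariant probability measure on $\mathbf P(\mathbb R^d)$ and let $\overline V_0$ be a random variable with distribution $\nu$, independent of $(A_n,B_n)_{n\ge1}$. Assume that there exist constants $\alpha>0$, $\beta>1+\frac1\alpha$ and $\gamma\ge\max\{\frac1\alpha,1\}$ such that - $\mathbb E\Big(\big(\ell_1^{(\rho)}(\overline V_0)\big)^\alpha\Big)<+\infty$ for every $\rho\in(0,1)$; - $\mathbb E\Big(\big(\ln^+C_1(\overline V_0)\big)^\beta\Big)<+\infty$; - $\mathbb E\big((\ln^+|B_1|)^\gamma\big)<+\infty$. For $x\in\mathbb R^d$ let $X_0^x=x$ and $X_{n+1}^x=A_{n+1}X_n^x+B_{n+1}$ for $n\ge0$. Then the affine recursion is recurrent: there exists $K>0$ such that for every $x\in\mathbb R^d$, $\mathbb P\big(\liminf_{n\to+\infty}|X_n^x|\le K\big)=1$.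
   Context: $\mathcal M(d,\mathbb R)$ is the set of real $d\times d$ matrices, $|\cdot|$ the Euclidean norm on $\mathbb R^d$, $\|A\|=\sup_{|x|=1}|Ax|$, $\ln^+t=\max(\ln t,0)$. $\bar\mu$ is the law of $A_1$ and $\gamma_{\bar\mu}=\lim_n\frac1n\mathbb E(\ln\|A_n\cdots A_1\|)$. $\mathbf P(\mathbb R^d)$ is the projective space of $\mathbb R^d$ and $\bar x$ the class of $x\ne0$. On $\mathcal X=\mathbf P(\mathbb R^d)\cup\{0\}$ matrices act by $A\cdot0=0$, and $A\cdot\bar x=\overline{Ax}$ if $Ax\ne0$, $A\cdot\bar x=0$ if $Ax=0$. For $\bar x\in\mathbf P(\mathbb R^d)$, $|A\bar x|:=|Ax|/|x|$ for any representative $x\neq 0$; $|A\,0|:=0$. A probability measure $\nu$ on $\mathbf P(\mathbb R^d)$ is $\bar\mu$-invariant if it is invariant for the Markov chain $\overline V_{n+1}=A_{n+1}\cdot\overline V_n$ on $\mathcal X$, i.e. if $\overline V_0\sim\nu$ is independent of $A_1$ then $A_1\cdot\overline V_0\sim\nu$ (in particular it lies in $\mathbf P(\mathbb R^d)$ almost surely). For $\bar v\in\mathbf P(\mathbb R^d)$ and $\rho\in(0,1)$, $\ell_1^{(\rho)}(\bar v):=\inf\{n\ge1:\ |A_n\cdots A_1\bar v|\le\rho\}\in\{1,2,\dots\}\cup\{+\infty\}$, and $$C_1(\bar v):=\sup_{n\ge1}\frac{\|A_n\cdots A_1\|}{|A_n\cdots A_1\bar v|}\in[1,+\infty],$$ with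 the conventions $\frac00=1$ and $\frac c0=+\infty$ for $c>0$. *)

(* Defs.v *)
From HB Require Import structures.
From mathcomp Require Import all_boot all_order all_algebra.
From mathcomp Require Import all_classical all_reals all_analysis.

Set Implicit Arguments.
Unset Strict Implicit.
Unset Printing Implicit Defensive.

Import Order.TTheory GRing.Theory Num.Theory.
Import numFieldNormedType.Exports.

Local Open Scope classical_set_scope.
Local Open Scope quotient_scope.
Local Open Scope ring_scope.

(* The library requires measurable types to be inhabited, so the dimension
   d >= 1 is written n.+1 below. *)

HB.instance Definition _ (R : realType) (m n : nat) :=
  @isMeasurable.Build (sigma_display (@open 'M[R]_(m, n))) 'M[R]_(m, n)
    <<s @open 'M[R]_(m, n) >> (@sigma_algebra0 _ setT _) (@sigma_algebraC _ _)
    (@sigma_algebra_bigcup _ setT _).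

(* The library norm `|x| on matrices is the sup norm, hence enorm. *)

Definition enorm (R : realType) (n : nat) (x : 'cV[R]_n) : R :=
  Num.sqrt (\sum_(i < n) x i 0 ^+ 2).

Definition opnorm (R : realType) (n : nat) (A : 'M[R]_n) : R :=
  sup [set enorm (A *m x) | x in [set x : 'cV[R]_n | enorm x = 1]].

Definition nzvec (R : realType) (n : nat) : Type :=
  set_type [set x : 'cV[R]_n.+1 | x != 0].

HB.instance Definition _ (R : realType) (n : nat) :=
  Topological.on (nzvec R n).

Section projective_space.
Context {R : realType} {n : nat}.

Definition colinear (x y : nzvec R n) : bool :=
  `[< exists2 c : R, c != 0 & val y = c *: val x >].

Lemma colinear_equiv : equiv_class_of colinear.
Proof.
split=> [x|x y|y x z].
- by apply/asboolP; exists 1; rewrite ?oner_eq0// scale1r.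
- by apply/asboolP/asboolP => -[c c0 E]; exists c^-1; rewrite ?invr_eq0//;
    rewrite E scalerA mulVf// scale1r.
- move=> /asboolP[c c0 E] /asboolP[e e0 F]; apply/asboolP; exists (e * c).
    by rewrite mulf_neq0.
  by rewrite F E scalerA.
Qed.

Canonical colinear_equiv_rel := EquivRelPack colinear_equiv.

End projective_space.

Definition projspace (R : realType) (n : nat) : Type :=
  quotient_topology {eq_quot @colinear_equiv_rel R n}.

HB.instance Definition _ (R : realType) (n : nat) :=
  Topological.on (projspace R n).
HB.instance Definition _ (R : realType) (n : nat) :=
  Quotient.on (projspace R n).

Lemma const1_neq0 (R : realType) (n : nat) :
  (const_mx 1 : 'cV[R]_n.+1) \in [set x : 'cV[R]_n.+1 | x != 0].
Proof.
rewrite inE/=; apply/eqP => /matrixP/(_ ord0 ord0).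
by rewrite !mxE => /eqP; rewrite oner_eq0.
Qed.

HB.instance Definition _ (R : realType) (n : nat) :=
  isPointed.Build (projspace R n)
    (\pi_(projspace R n) (SigSub (const1_neq0 R n) : nzvec R n)).

HB.instance Definition _ (R : realType) (n : nat) :=
  @isMeasurable.Build (sigma_display (@open (projspace R n))) (projspace R n)
    <<s @open (projspace R n) >> (@sigma_algebra0 _ setT _) (@sigma_algebraC _ _)
    (@sigma_algebra_bigcup _ setT _).

Section action.
Context {R : realType} {n : nat}.

Definition prep (v : projspace R n) : 'cV[R]_n.+1 := val (repr v).

(* The class of x in P(R^d) \cup {0}, where None stands for the point 0:
   insub x is None exactly when x = 0. *)
Definition pclass (x : 'cV[R]_n.+1) : option (projspace R n) :=
  omap (fun y : nzvec R n => \pi_(projspace R n) y) (insub x).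

Definition pact (A : 'M[R]_n.+1) (u : option (projspace R n)) :
    option (projspace R n) :=
  if u is Some v then pclass (A *m prep v) else None.

Definition pgain (A : 'M[R]_n.+1) (v : projspace R n) : R :=
  enorm (A *m prep v) / enorm (prep v).

(* pact and pgain do not depend on the chosen representative *)
Lemma prep_pclass (x : 'cV[R]_n.+1) (v : projspace R n) :
  pclass x = Some v -> exists2 c : R, c != 0 & x = c *: prep v.
Proof.
rewrite /pclass; case: insubP => //= y _ <- [<-].
have /eqmodP/asboolP[c c0 E] :
    repr (\pi_(projspace R n) y) = y %[mod {eq_quot @colinear_equiv_rel R n}].
  exact: (reprK (\pi_(projspace R n) y)).
exists c => //.
Qed.

Lemma pclassZ (c : R) (x : 'cV[R]_n.+1) :
  c != 0 -> pclass (c *: x) = pclass x.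
Proof.
move=> c0; have [->|x0] := eqVneq x 0; first by rewrite scaler0.
have cx0 : c *: x != 0 by rewrite scaler_eq0 negb_or c0.
rewrite /pclass.
case: insubP => [y _ /= yE|]; last by move=> /negP[]; exact: mem_set.
case: insubP => [z _ /= zE|]; last by move=> /negP[]; exact: mem_set.
congr Some; apply/eqmodP/asboolP; exists c^-1; rewrite ?invr_eq0//.
by rewrite /= yE zE scalerA mulVf// scale1r.
Qed.

Lemma pclass0 : pclass 0 = None.
Proof.
by rewrite /pclass; case: insubP => // y /set_mem /=; rewrite eqxx.
Qed.

Lemma pactE (A : 'M[R]_n.+1) (x : 'cV[R]_n.+1) :
  pact A (pclass x) = pclass (A *m x).
Proof.
case E : (pclass x) => [v|] /=.
  by have [c c0 ->] := prep_pclass E; rewrite -scalemxAr pclassZ.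
suff -> : x = 0 by rewrite mulmx0 pclass0.
apply/eqP; apply: contraTT isT => x0; move: E; rewrite /pclass.
by case: insubP => // /negP[]; exact: mem_set.
Qed.

Lemma pgainE (A : 'M[R]_n.+1) (x : 'cV[R]_n.+1) (v : projspace R n) :
  pclass x = Some v -> pgain A v = enorm (A *m x) / enorm x.
Proof.
move=> /prep_pclass[c c0 ->]; rewrite /pgain -scalemxAr.
have enormZ (y : 'cV[R]_n.+1) : enorm (c *: y) = `|c| * enorm y.
  rewrite /enorm (eq_bigr (fun i => c ^+ 2 * y i 0 ^+ 2)); last first.
    by move=> i _; rewrite mxE exprMn.
  by rewrite -big_distrr/= sqrtrM ?sqr_ge0// sqrtr_sqr.
by rewrite !enormZ -mulf_div divff ?mul1r// normr_eq0.
Qed.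

End action.

(* Indices are shifted: A k and B k stand for A_{k+1} and B_{k+1}, so that
   mxprods k is A_k ... A_1. *)

Section recursion.
Context {R : realType} {T : Type} {n : nat}.
Variables (A : nat -> T -> 'M[R]_n.+1) (B : nat -> T -> 'cV[R]_n.+1).

Fixpoint mxprods (k : nat) (w : T) : 'M[R]_n.+1 :=
  if k is k'.+1 then A k' w *m mxprods k' w else 1%:M.

Fixpoint affine_rec (x : 'cV[R]_n.+1) (k : nat) (w : T) : 'cV[R]_n.+1 :=
  if k is k'.+1 then A k' w *m affine_rec x k' w + B k' w else x.

Definition ell1 (rho : R) (v : projspace R n) (w : T) : \bar R :=
  ereal_inf [set k%:R%:E | k in
    [set k : nat | (1 <= k)%N /\ pgain (mxprods k w) v <= rho]].

(* quotient with the conventions 0/0 = 1 and c/0 = +oo for c > 0 *)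
Definition eratio (a b : R) : \bar R :=
  if b == 0 then (if a == 0 then 1%E else +oo%E) else (a / b)%:E.

Definition C1 (v : projspace R n) (w : T) : \bar R :=
  ereal_sup [set eratio (opnorm (mxprods k w)) (pgain (mxprods k w) v) | k in
    [set k : nat | (1 <= k)%N]].

End recursion.

(* lne (unlike ln) satisfies lne 0 = -oo, lne +oo = +oo *)
Definition lnep (R : realType) (x : \bar R) : \bar R := maxe (lne x) 0%E.

Section probabilistic_notions.
Context d (T : measurableType d) {R : realType} (P : probability T R).

Definition mutually_independent d' (T' : measurableType d')
    (X : nat -> T -> T') : Prop :=
  forall (s : seq nat) (E : nat -> set T'), uniq s ->
    (forall i, measurable (E i)) ->
    P (\bigcap_(i in [set` s]) (X i @^-1` E i)) =
    (\prod_(i <- s) P (X i @^-1` E i))%E.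

Definition identically_distributed d' (T' : measurableType d')
    (X : nat -> T -> T') : Prop :=
  forall (i j : nat) (E : set T'), measurable E ->
    P (X i @^-1` E) = P (X j @^-1` E).

Definition independent_of_sequence d1 d2 (T1 : measurableType d1)
    (T2 : measurableType d2) (V : T -> T1) (X : nat -> T -> T2) : Prop :=
  forall F G : set T,
    g_sigma_algebra_preimage V F ->
    <<s \bigcup_i g_sigma_algebra_preimage (X i) >> G ->
    P (F `&` G) = (P F * P G)%E.

(* gamma_mu = g: the limit of E(ln |A_k ... A_1|)/k, where ln 0 = -oo *)
Definition lyapunov_exponent_is (n : nat) (A : nat -> T -> 'M[R]_n.+1)
    (g : \bar R) : Prop :=
  (k%:R^-1%:E * \int[P]_w lne (opnorm (mxprods A k w))%:E)%E
    @[k --> \oo] --> g.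

End probabilistic_notions.

(* nu is invariant: for V_0 of law nu and A of law mu independent, i.e. with
   joint law mu \x nu, the law of A . V_0 on P(R^d) \cup {0} is nu *)
Definition proj_invariant (R : realType) (n : nat)
    (mu : probability 'M[R]_n.+1 R) (nu : probability (projspace R n) R) : Prop :=
  forall U : set (projspace R n), measurable U ->
    (mu \x nu)%E [set p | (Some @` U) (pact p.1 (Some p.2))] = nu U.

(* Main.v *)
(** Draw a direction V of law nu, independent of everything, and run the recursion
up to the first time l at which |A_l ... A_1 V| <= rho.  The linear part of this
block has norm at most C_1(V) rho; since E ln C_1(V) is finite, the block contracts
in logarithmic mean once rho is small.  For i < l, the norm of A_l ... A_{i+1} is at
most the constant C_1 of the shifted sequence at the direction V_i of A_i ... A_1 V,
because |A_l ... A_1 V| <= rho < |A_i ... A_1 V|; as V_i has law nu again, all these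
constants have the same moment of order beta.  If c_i denotes their logarithms, then
c_i <= i^alpha + c_i^beta i^(- alpha (beta - 1)) with alpha (beta - 1) > 1, so
max_(i <= l) c_i is at most l^alpha plus an integrable series; the translation parts
are treated likewise, {l >= i} being independent of B_i.  Hence, for K large,
ln (1 + |x|) decreases in mean by at least 1 over a block started at |x| > K.  By the
Markov property the probability g(x) of never entering the ball of radius K satisfies
m g(x) <= ln (1 + |x|) for every m, so g = 0. *)

Require Import Defs.
From HB Require Import structures.
From mathcomp Require Import all_boot all_order all_algebra.
From mathcomp Require Import all_classical all_reals all_analysis.
From mathcomp Require Import measurable_realfun ring lra.

Set Implicit Arguments.
Unset Strict Implicit.
Unset Printing Implicit Defensive.

Import Order.TTheory GRing.Theory Num.Theory.
Import numFieldNormedType.Exports.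

Local Open Scope classical_set_scope.
Local Open Scope ring_scope.

(** * Measurability of matrices and of the projective space *)

(** The direction has to be redrawn for each block: the direction reached at the random time l need
    not have law nu, so the moment assumptions say nothing about what follows it. Redrawing is free,
    because g involves only the sequence (A_n, B_n). The Markov property is applied with V counted
    in the past, and the induction hypothesis on m is then used at X_l with V independent again.

    Within a block, l and the constants c_i depend on one another in an uncontrolled way, and only
    the separate moments are known. This is why the bound on max c_i is pathwise and splits into a
    power of l and a series whose mean is computed term by term. Each c_i involves the whole future
    after i, so it is built as a limit of running maxima over finite horizons, to which the Markov
    property of a suitable chain applies.

    Directions are handled through orthogonal projectors onto lines: a representative vector is
    obtained by choice, whereas the projector is a measurable function of the line. *)

Section matrix_measurability.
Context d (T : measurableType d) (R : realType).

(* An open set of matrices is a countable union of cubes with rational centre,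
   so the Borel sets of matrices are generated by the entries. *)
Lemma measurable_fun_mx m n (f : T -> 'M[R]_(m, n)) :
  (forall i j, measurable_fun setT (fun t => f t i j)) ->
  measurable_fun setT f.
Proof.
move=> mf; apply: (@measurability _ _ _ _ _ _ (@open 'M[R]_(m, n))) => //.
move=> _ [U oU <-]; rewrite setTI.
pose I := ('M[rat]_(m, n) * nat)%type.
pose c (i : I) : 'M[R]_(m, n) := map_mx ratr i.1.
pose r (i : I) : R := i.2.+1%:R^-1.
pose box (i : I) := [set x : 'M[R]_(m, n) | forall k l, `|c i k l - x k l| < r i].
pose F (i : I) := if `[< box i `<=` U >] then f @^-1` box i else set0.
have -> : f @^-1` U = \bigcup_i F i.
  apply/seteqP; split => [t /= Uft|t [i _]]; last first.
    by rewrite /F; case: asboolP => // bU; exact: bU.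
  have : nbhs (f t) U by rewrite nbhsE; exists U.
  move=> /nbhs_ballP[e /= e0 beU].
  have [N Ne] : exists N, N.+1%:R^-1 < e / 2 :> R.
    have e20 : 0 < e / 2 by rewrite divr_gt0.
    have [N _ /(_ N)] := near_infty_natSinv_lt (PosNum e20).
    by move=> /(_ (leqnn _)) ?; exists N.
  have qP k l : exists q : rat, `|ratr q - f t k l| < N.+1%:R^-1 :> R.
    have /rat_in_itvoo[q] : f t k l - N.+1%:R^-1 < f t k l + N.+1%:R^-1.
      by rewrite ltrD2l gtrN// invr_gt0.
    rewrite in_itv/= => /andP[q1 q2]; exists q.
    by rewrite ltr_norml ltrBrDl q1/= ltrBlDl.
  pose q k l := projT1 (cid (qP k l)).
  have qE k l : `|ratr (q k l) - f t k l| < N.+1%:R^-1 :> R.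
    by rewrite /q; case: cid.
  exists (\matrix_(k, l) q k l, N) => //; rewrite /F; case: asboolP.
    by move=> _ k l; rewrite /c/= !mxE; exact: qE.
  move=> []; move=> x bx; apply: beU; split => // k l.
  rewrite /ball/=; have := bx k l; rewrite /c /= !mxE => h1.
  have h2 := qE k l.
  rewrite (_ : _ - _ = (f t k l - ratr (q k l)) + (ratr (q k l) - x k l)).
    rewrite (le_lt_trans (ler_normD _ _))// [ltRHS](splitr e).
    by rewrite ltrD// ?(lt_trans h1)// distrC (lt_trans h2).
  by rewrite addrA subrK.
apply: countable_bigcupT_measurable.
  exact: countableP.
move=> i; rewrite /F; case: ifP => _ //.
rewrite (_ : _ @^-1` _ = \bigcap_k \bigcap_l
    ((fun t => `|c i k l - f t k l|) @^-1` [set` `]-oo, r i[])); last first.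
  apply/seteqP; split => t /=.
    by move=> h k _ l _ /=; rewrite in_itv/=; exact: h.
  by move=> h k l; have := h k Logic.I l Logic.I; rewrite /= in_itv.
apply: fin_bigcap_measurable => // k _; apply: fin_bigcap_measurable => // l _.
rewrite -[X in measurable X]setTI.
apply: (measurableT_comp (@normr_measurable R setT)) => //.
by apply: measurable_funB.
Qed.

Lemma measurable_mx_entry m n (i : 'I_m) (j : 'I_n) (f : T -> 'M[R]_(m, n)) :
  measurable_fun setT f -> measurable_fun setT (fun t => f t i j).
Proof.
move=> mf; apply: (@measurableT_comp _ _ _ _ _ _ (fun M : 'M[R]_(m, n) => M i j)) => //.
apply: (measurability _ (RGenOInfty.measurableE R)) => //.
move=> _ [_ [x ->] <-]; rewrite setTI; apply: sub_sigma_algebra.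
by move/continuousP : (@coord_continuous R m n i j); apply; exact: rray_open.
Qed.

Lemma measurable_fun_addmx m n (f g : T -> 'M[R]_(m, n)) :
  measurable_fun setT f -> measurable_fun setT g ->
  measurable_fun setT (fun t => f t + g t).
Proof.
move=> mf mg; apply: measurable_fun_mx => i j.
rewrite (_ : (fun _ => _) = (fun t => f t i j + g t i j)); last first.
  by apply/funext => t; rewrite mxE.
by apply: measurable_funD; exact: measurable_mx_entry.
Qed.

Lemma measurable_fun_sumr (I : Type) (s : seq I) (h : I -> T -> R) :
  (forall i, measurable_fun setT (h i)) ->
  measurable_fun setT (fun t => \sum_(i <- s) h i t).
Proof.
move=> mh; elim: s => [|i s ih].
  rewrite (_ : (fun _ => _) = cst 0); first exact: measurable_cst.
  by apply/funext => t; rewrite big_nil.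
rewrite (_ : (fun _ => _) = (fun t => h i t + \sum_(i <- s) h i t)).
  exact: measurable_funD.
by apply/funext => t; rewrite big_cons.
Qed.

Lemma measurable_fun_mulmx m n p (f : T -> 'M[R]_(m, n)) (g : T -> 'M[R]_(n, p)) :
  measurable_fun setT f -> measurable_fun setT g ->
  measurable_fun setT (fun t => f t *m g t).
Proof.
move=> mf mg; apply: measurable_fun_mx => i j.
rewrite (_ : (fun _ => _) = (fun t => \sum_k f t i k * g t k j)); last first.
  by apply/funext => t; rewrite mxE.
apply: measurable_fun_sumr => k.
by apply: measurable_funM; exact: measurable_mx_entry.
Qed.

Lemma measurable_fun_sqrt (f : T -> R) : measurable_fun setT f ->
  measurable_fun setT (fun t => Num.sqrt (f t)).
Proof.
move=> mf; apply: (measurableT_comp _ mf).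
by apply: continuous_measurable_fun => x; exact: sqrt_continuous.
Qed.

Lemma measurable_fun_enorm m (f : T -> 'cV[R]_m) :
  measurable_fun setT f -> measurable_fun setT (fun t => enorm (f t)).
Proof.
move=> mf; apply: measurable_fun_sqrt; apply: measurable_fun_sumr => i.
by apply: measurable_funX; exact: measurable_mx_entry.
Qed.

End matrix_measurability.

(** * Euclidean norm and operator norm *)

Section euclidean_norm.
Context {R : realType}.

Lemma enorm_ge0 n (x : 'cV[R]_n) : 0 <= enorm x.
Proof. exact: sqrtr_ge0. Qed.

Lemma sumsq_ge0 n (a : 'I_n -> R) : 0 <= \sum_i a i ^+ 2.
Proof. by apply: sumr_ge0 => i _; exact: sqr_ge0. Qed.

Lemma enorm_eq0 n (x : 'cV[R]_n) : (enorm x == 0) = (x == 0).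
Proof.
rewrite sqrtr_eq0; apply/idP/eqP => [h|->]; last first.
  by rewrite big1// => i _; rewrite mxE expr0n.
have /eqP : \sum_i x i 0 ^+ 2 = 0 by apply/eqP; rewrite eq_le h sumsq_ge0.
rewrite psumr_eq0; last by move=> i _; exact: sqr_ge0.
move=> /allP/= h0; apply/colP => i; rewrite mxE; apply/eqP.
by have := h0 i (mem_index_enum i); rewrite sqrf_eq0.
Qed.

Lemma enorm0 n : enorm (0 : 'cV[R]_n) = 0.
Proof. by apply/eqP; rewrite enorm_eq0. Qed.

Lemma enormZ n (c : R) (x : 'cV[R]_n) : enorm (c *: x) = `|c| * enorm x.
Proof.
rewrite /enorm -sqrtr_sqr -sqrtrM ?sqr_ge0// mulr_sumr; congr Num.sqrt.
by apply: eq_bigr => i _; rewrite mxE exprMn.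
Qed.

Lemma cauchy_schwarz n (a b : 'I_n -> R) :
  (\sum_i a i * b i) ^+ 2 <= (\sum_i a i ^+ 2) * (\sum_i b i ^+ 2).
Proof.
rewrite -subr_ge0 -(pmulrn_lge0 _ (ltn0Sn 1)).
(* Lagrange's identity, doubled so that the sum runs over all ordered pairs of indices. *)
have -> : ((\sum_i a i ^+ 2) * (\sum_i b i ^+ 2) - (\sum_i a i * b i) ^+ 2) *+ 2 =
    \sum_i \sum_j (a i * b j - a j * b i) ^+ 2.
  under [RHS]eq_bigr do under eq_bigr do rewrite sqrrB.
  under [RHS]eq_bigr do rewrite big_split/= sumrB.
  rewrite big_split/= sumrB mulrnBl.
  rewrite (_ : \sum_i \sum_i0 (a i * b i0) ^+ 2 = (\sum_i a i ^+ 2) * (\sum_i b i ^+ 2)).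
    rewrite (_ : \sum_i \sum_i0 (a i0 * b i) ^+ 2 = (\sum_i a i ^+ 2) * (\sum_i b i ^+ 2)).
      rewrite (_ : \sum_i \sum_i0 _ *+ 2 = (\sum_i a i * b i) ^+ 2 *+ 2).
        by rewrite mulr2n addrAC.
      rewrite expr2 big_distrlr/= -sumrMnl; apply: eq_bigr => i _.
      rewrite -sumrMnl; apply: eq_bigr => j _.
      by congr (_ *+ 2); ring.
    rewrite exchange_big/= big_distrlr/=.
    by apply: eq_bigr => i _; apply: eq_bigr => j _; rewrite exprMn.
  rewrite big_distrlr/=.
  by apply: eq_bigr => i _; apply: eq_bigr => j _; rewrite exprMn.
by apply: sumr_ge0 => i _; exact: sumsq_ge0.
Qed.

Lemma enorm_sqr n (x : 'cV[R]_n) : enorm x ^+ 2 = \sum_i x i 0 ^+ 2.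
Proof. by rewrite sqr_sqrtr// sumsq_ge0. Qed.

Lemma enormD n (x y : 'cV[R]_n) : enorm (x + y) <= enorm x + enorm y.
Proof.
rewrite -(@ler_pXn2r _ 2)// ?nnegrE ?addr_ge0 ?enorm_ge0//.
rewrite sqrrD !enorm_sqr.
under eq_bigr do rewrite mxE sqrrD.
rewrite big_split/= big_split/= lerD2r lerD2l sumrMnl lerMn2r/=.
apply: (le_trans (ler_norm _)).
rewrite -(@ler_pXn2r _ 2)// ?nnegrE ?mulr_ge0 ?enorm_ge0//.
by rewrite real_normK ?num_real// exprMn !enorm_sqr cauchy_schwarz.
Qed.

Lemma enorm_sum n (I : Type) (s : seq I) (x : I -> 'cV[R]_n) :
  enorm (\sum_(i <- s) x i) <= \sum_(i <- s) enorm (x i).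
Proof.
elim: s => [|i s ih]; first by rewrite !big_nil enorm0.
by rewrite !big_cons (le_trans (enormD _ _))// lerD2l.
Qed.

(** The Frobenius norm serves to bound the set that defines [opnorm]; without a bound, [sup] would
    be a default value. *)
Let frob n (A : 'M[R]_n) := Num.sqrt (\sum_i \sum_j A i j ^+ 2).

Let enorm_mulmx_frob n (A : 'M[R]_n) (x : 'cV[R]_n) :
  enorm (A *m x) <= frob A * enorm x.
Proof.
rewrite -sqrtrM; last by apply: sumr_ge0 => i _; exact: sumsq_ge0.
apply: ler_wsqrtr; rewrite mulr_suml; apply: ler_sum => i _.
by rewrite mxE; exact: cauchy_schwarz.
Qed.

Lemma opnorm_has_sup n (A : 'M[R]_n.+1) :
  has_sup [set enorm (A *m x) | x in [set x : 'cV[R]_n.+1 | enorm x = 1]].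
Proof.
split.
  exists (enorm (A *m delta_mx 0 0)), (delta_mx 0 0) => //=.
  rewrite /enorm big_ord_recl !mxE !eqxx expr1n big1 ?addr0 ?sqrtr1// => i _.
  by rewrite !mxE /= expr0n.
by exists (frob A) => _ [x /= x1 <-]; rewrite (le_trans (enorm_mulmx_frob _ _))// x1 mulr1.
Qed.

Lemma enorm_mulmx n (A : 'M[R]_n.+1) (x : 'cV[R]_n.+1) :
  enorm (A *m x) <= opnorm A * enorm x.
Proof.
have [->|x0] := eqVneq x 0; first by rewrite mulmx0 enorm0 mulr0.
have xp : 0 < enorm x by rewrite lt_def enorm_ge0 enorm_eq0 x0.
rewrite -ler_pdivrMr//.
rewrite (_ : _ / _ = enorm (A *m ((enorm x)^-1 *: x))).
  apply: sup_upper_bound; first exact: opnorm_has_sup.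
  exists ((enorm x)^-1 *: x) => //=.
  by rewrite enormZ ger0_norm ?invr_ge0 ?enorm_ge0// mulVf// gt_eqF.
by rewrite -scalemxAr enormZ ger0_norm ?invr_ge0 ?enorm_ge0// mulrC.
Qed.

Lemma opnorm_ge0 n (A : 'M[R]_n.+1) : 0 <= opnorm A.
Proof.
have [[_ [x /= x1 _]] _] := opnorm_has_sup A.
apply: le_trans (enorm_ge0 (A *m x)) _.
by apply: sup_upper_bound; [exact: opnorm_has_sup|exists x].
Qed.

(** The unit sphere is uncountable, so measurability comes from lower semicontinuity: the set where
    [t < opnorm A] is a union of open sets, one for each unit vector. *)
Lemma measurable_opnorm n : measurable_fun setT (@opnorm R n.+1).
Proof.
apply: (measurability _ (RGenOInfty.measurableE R)) => //.
move=> _ [_ [t ->] <-]; rewrite setTI; apply: sub_sigma_algebra.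
rewrite (_ : _ @^-1` _ = \bigcup_(x in [set x : 'cV[R]_n.+1 | enorm x = 1])
    [set A : 'M[R]_n.+1 | t < enorm (A *m x)]).
  apply: bigcup_open => x _.
  rewrite [X in open X](_ : _ =
    (fun A : 'M[R]_n.+1 => enorm (A *m x)) @^-1` `]t, +oo[); last first.
    by apply/seteqP; split => A /=; rewrite in_itv/= andbT.
  apply: open_comp; last exact: rray_open.
  move=> A _; apply: (@continuous_comp _ _ _ (fun A : 'M[R]_n.+1 => \sum_i (A *m x) i 0 ^+ 2)
    (@Num.sqrt R)); last exact: sqrt_continuous.
  rewrite (_ : (fun _ => _) = (fun A : 'M[R]_n.+1 =>
    \sum_i (\sum_j A i j * x j 0) * (\sum_j A i j * x j 0))); last first.
    by apply/funext => B; apply: eq_bigr => i _; rewrite !mxE.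
  apply: continuous_big => [|i _]; first exact: add_continuous.
  move=> B.
  have c : {for B, continuous (fun A : 'M[R]_n.+1 => \sum_j A i j * x j 0)}.
    apply: continuous_big => [|j _]; first exact: add_continuous.
    move=> C; apply: continuousM; first exact: coord_continuous.
    exact: cst_continuous.
  exact: continuousM.
apply/seteqP; split => A /=.
  rewrite in_itv/= andbT => tA.
  have [_ [x x1 <-] tx] := sup_gt (proj1 (opnorm_has_sup A)) tA.
  by exists x.
move=> [x x1 tx]; rewrite in_itv/= andbT (lt_le_trans tx)//.
by apply: sup_upper_bound; [exact: opnorm_has_sup|exists x].
Qed.

End euclidean_norm.

(** * The projective space seen through orthogonal projectors *)

Section projective_measurability.
Context {R : realType} {n : nat}.
Local Open Scope quotient_scope.
Local Notation M := 'M[R]_n.+1.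
Local Notation V := 'cV[R]_n.+1.
Local Notation P := (projspace R n).

Lemma prep_neq0 (v : P) : prep v != 0.
Proof. by have /set_mem := valP (repr v). Qed.

Lemma pclass_prep (v : P) : pclass (prep v) = Some v.
Proof. by rewrite /pclass /prep valK /= reprK. Qed.

Lemma pclass_neq0 (x : V) : x != 0 -> exists v, pclass x = Some v.
Proof.
move=> x0; rewrite /pclass; case: insubP => [y _ _|]; first by eexists.
by move=> /negP[]; exact: mem_set.
Qed.

Lemma mxtrace_outer (x : V) : \tr (x *m x^T) = enorm x ^+ 2.
Proof.
rewrite enorm_sqr; apply: eq_bigr => i _.
by rewrite mxE big_ord1 mxE expr2.
Qed.

(* The orthogonal projector onto the line v: the nonzero columns of dirmx v
   represent v, so that dirmx generates the Borel sets of the projective space. *)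
Definition dirmx (v : P) : M := (enorm (prep v) ^+ 2)^-1 *: (prep v *m (prep v)^T).

Lemma dirmx_pclass (x : V) (v : P) : pclass x = Some v ->
  dirmx v = (enorm x ^+ 2)^-1 *: (x *m x^T).
Proof.
move=> /prep_pclass[c c0 ->]; rewrite enormZ exprMn invfM real_normK ?num_real//.
rewrite linearZ/= -scalemxAr -scalemxAl !scalerA; congr (_ *: _).
by rewrite mulrAC -mulrA mulrC -!mulrA; field; rewrite c0 enorm_eq0 prep_neq0.
Qed.

Lemma col_dirmx_pclass (v : P) : exists i, pclass (col i (dirmx v)) = Some v.
Proof.
have /matrix0Pn[i [j]] := prep_neq0 v; rewrite ord1 => xi0.
exists i; rewrite (_ : col i _ = ((enorm (prep v) ^+ 2)^-1 * prep v i 0) *: prep v).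
  rewrite pclassZ ?pclass_prep// mulf_neq0// invr_eq0 expf_eq0/=.
  by rewrite enorm_eq0 prep_neq0.
by apply/colP => k; rewrite !mxE big_ord1 !mxE; ring.
Qed.

Lemma pclass_col_dirmx (v w : P) i : pclass (col i (dirmx v)) = Some w -> w = v.
Proof.
rewrite (_ : col i _ = ((enorm (prep v) ^+ 2)^-1 * prep v i 0) *: prep v).
  have [->|c0] := eqVneq ((enorm (prep v) ^+ 2)^-1 * prep v i 0) 0.
    by rewrite scale0r pclass0.
  by rewrite pclassZ// pclass_prep => -[].
by apply/colP => k; rewrite !mxE big_ord1 !mxE; ring.
Qed.

Lemma dirmx_entry_continuous i j : continuous (fun v : P => dirmx v i j).
Proof.
apply/(@quotient_continuous (nzvec R n)).
rewrite (_ : _ \o _ = fun y : nzvec R n =>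
    (\sum_k val y k 0 * val y k 0)^-1 * (val y i 0 * val y j 0)); last first.
  apply/funext => y /=.
  rewrite (@dirmx_pclass (val y)) ?mxE ?big_ord1 ?mxE ?enorm_sqr//.
  by rewrite /pclass valK.
have cv k : continuous (fun y : nzvec R n => val y k 0 : R).
  move=> y; apply: (@continuous_comp _ _ _ (val : nzvec R n -> V) (fun x : V => x k 0)).
    exact: initial_continuous.
  exact: coord_continuous.
move=> y; apply: (@continuousM R (nzvec R n)); last by apply: (@continuousM R (nzvec R n)); exact: cv.
apply: continuousV.
  have := set_mem (valP y); rewrite /= -enorm_eq0 -sqrf_eq0 enorm_sqr.
  by congr (~~ (_ == _)); apply: eq_bigr => k _; rewrite expr2.
apply: continuous_big => [|k _]; first exact: add_continuous.
by move=> z; apply: continuousM; exact: cv.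
Qed.

Lemma measurable_dirmx : measurable_fun setT dirmx.
Proof.
apply: measurable_fun_mx => i j.
apply: (measurability _ (RGenOInfty.measurableE R)) => //.
move=> _ [_ [x ->] <-]; rewrite setTI; apply: sub_sigma_algebra.
by move/continuousP : (@dirmx_entry_continuous i j); apply; exact: rray_open.
Qed.

Lemma pgain_ge0 (a : M) (v : P) : 0 <= pgain a v.
Proof. by rewrite divr_ge0 ?enorm_ge0. Qed.

(** Like [dirmx_pmove] below, this eliminates the chosen representative [prep v] in favour of the
    entries of [a] and [dirmx v], which are measurable. *)
Lemma pgain_sqr (a : M) (v : P) : pgain a v ^+ 2 = \tr (a *m dirmx v *m a^T).
Proof.
rewrite /dirmx -scalemxAr -scalemxAl mxtraceZ.
rewrite -!mulmxA -trmx_mul mulmxA mxtrace_outer.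
by rewrite /pgain expr_div_n mulrC.
Qed.

Lemma pgain_eq0 (a : M) (v : P) : (pgain a v == 0) = (a *m prep v == 0).
Proof.
by rewrite mulf_eq0 invr_eq0 !enorm_eq0 (negbTE (prep_neq0 v)) orbF.
Qed.

Lemma pact_eq_none (a : M) (v : P) : (pact a (Some v) == None) = (pgain a v == 0).
Proof.
rewrite pgain_eq0 /=; apply/eqP/eqP => [|->]; last exact: pclass0.
by move=> h; apply/eqP; apply: contraTT isT => /pclass_neq0[w]; rewrite h.
Qed.

(** When [a] kills [v] the value is an arbitrary point. Invariance of nu makes this event negligible
    along the walk, see [law_pwalk], so that the walk can live in the projective space without the
    extra point 0. *)
Definition pmove (a : M) (v : P) : P := odflt point (pact a (Some v)).

Lemma dirmx_pmove (a : M) (v : P) : dirmx (pmove a v) =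
  if pgain a v == 0 then dirmx point
  else (pgain a v ^+ 2)^-1 *: (a *m dirmx v *m a^T).
Proof.
rewrite -pact_eq_none /pmove; case E : (pact a (Some v)) => [w|//] /=.
rewrite (dirmx_pclass E) /pgain /dirmx -scalemxAr -scalemxAl scalerA.
rewrite trmx_mul !mulmxA; congr (_ *: _).
have : enorm (prep v) != 0 by rewrite enorm_eq0 prep_neq0.
have : enorm (a *m prep v) != 0.
  rewrite enorm_eq0; apply/eqP => h0; move: E => /=.
  by rewrite h0 pclass0.
by move=> h1 h2; field; rewrite h1 h2.
Qed.

Section measurable_functions.
Context d (T : measurableType d).

Lemma measurable_fun_projspace (f : T -> P) :
  measurable_fun setT (fun t => dirmx (f t)) -> measurable_fun setT f.
Proof.
move=> mf; apply: (@measurability _ _ _ _ _ _ (@open P)) => //.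
move=> _ [U oU <-]; rewrite setTI.
have [W0 oW0 W0U] : exists2 W0 : set V, open W0 &
    val @^-1` W0 = (\pi_P @^-1` U : set (nzvec R n)).
  exact: oU.
(* [W0] is determined only away from the origin; [W] is the cone of all representatives of points of
   [U]. *)
pose W := W0 `&` [set x : V | x != 0].
have mW : measurable W.
  apply: measurableI; first exact: sub_sigma_algebra.
  rewrite [X in measurable X](_ : _ = (@enorm R n.+1) @^-1` (~` [set 0])); last first.
    apply/seteqP; split => x /=; first by move/eqP => x0 /eqP; rewrite enorm_eq0 => /eqP.
    by move=> x0; rewrite -enorm_eq0; exact/eqP.
  rewrite -[X in measurable X]setTI.
  apply: (@measurable_fun_enorm _ _ _ _ id) => //.
  exact: measurableC.
have WE (x : V) : W x <-> exists2 v, pclass x = Some v & U v.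
  split=> [[W0x /= x0]|[v xv Uv]].
    have x0' : x \in [set x : V | x != 0] by exact: mem_set.
    exists (\pi_P (SigSub x0' : nzvec R n)).
      by rewrite /pclass insubT.
    have : (val @^-1` W0) (SigSub x0' : nzvec R n) by [].
    by rewrite W0U.
  move: xv; rewrite /pclass; case: insubP => //= y + yx [yv].
  move=> /set_mem/= x0; split => //.
  have : (val @^-1` W0) y by rewrite W0U /= yv.
  by rewrite /= yx.
rewrite (_ : _ @^-1` _ = \bigcup_i ((fun t => col i (dirmx (f t))) @^-1` W)).
  apply: fin_bigcup_measurable => // i _; rewrite -[X in measurable X]setTI.
  suff : measurable_fun setT (fun t => col i (dirmx (f t))) by apply.
  apply: measurable_fun_mx => k l.
  rewrite (_ : (fun _ => _) = (fun t => dirmx (f t) k i)).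
    exact: measurable_mx_entry.
  by apply/funext => t; rewrite mxE.
apply/seteqP; split => t /=.
  move=> Uft; have [i iE] := col_dirmx_pclass (f t).
  by exists i => //; apply/WE; exists (f t).
by move=> [i _] /WE[v /pclass_col_dirmx ->].
Qed.

Lemma measurable_fun_trmx p q (f : T -> 'M[R]_(p, q)) : measurable_fun setT f ->
  measurable_fun setT (fun t => (f t)^T).
Proof.
move=> mf; apply: measurable_fun_mx => i j.
rewrite (_ : (fun _ => _) = (fun t => f t j i)); first exact: measurable_mx_entry.
by apply/funext => t; rewrite mxE.
Qed.

Variables (f : T -> M) (h : T -> P).
Hypotheses (mf : measurable_fun setT f) (mh : measurable_fun setT h).

Let mg : measurable_fun setT (fun t => f t *m dirmx (h t) *m (f t)^T).
Proof.
apply: measurable_fun_mulmx; last exact: measurable_fun_trmx.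
apply: measurable_fun_mulmx => //; apply: (measurableT_comp _ mh).
exact: measurable_dirmx.
Qed.

Lemma measurable_fun_pgain : measurable_fun setT (fun t => pgain (f t) (h t)).
Proof.
rewrite (_ : (fun _ => _) = (fun t => Num.sqrt (\tr (f t *m dirmx (h t) *m (f t)^T)))).
  by apply: measurable_fun_sqrt; apply: measurable_fun_sumr => i; exact: measurable_mx_entry.
by apply/funext => t; rewrite -pgain_sqr sqrtr_sqr ger0_norm ?pgain_ge0.
Qed.

Lemma measurable_fun_pmove : measurable_fun setT (fun t => pmove (f t) (h t)).
Proof.
apply: measurable_fun_projspace.
under eq_fun do rewrite dirmx_pmove.
apply: measurable_fun_ifT => //.
  apply: measurable_fun_eqr => //; exact: measurable_fun_pgain.
apply: measurable_fun_mx => i j; under eq_fun do rewrite mxE.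
apply: measurable_funM; last exact: measurable_mx_entry.
under eq_fun do rewrite -powR_inv1 ?sqr_ge0//.
apply: (@measurableT_comp _ _ _ _ _ _ (fun x : R => x `^ (-1))).
  exact: measurable_powR.
apply: measurable_funX; exact: measurable_fun_pgain.
Qed.

End measurable_functions.
End projective_measurability.

(** * The natural filtration and the Markov property *)

Section independent_integral.
Context d (T : measurableType d) (R : realType) (P : probability T R).
Local Open Scope ereal_scope.

(** Independence on rectangles identifies the joint law with the product of the laws, and Tonelli
    separates the integrals. *)
Lemma ge0_integral_indep d1 d2 (S : measurableType d1) (E : measurableType d2)
    (X : T -> S) (Y : T -> E) (f : S * E -> \bar R) :
  measurable_fun setT X -> measurable_fun setT Y ->
  (forall A B, measurable A -> measurable B ->
    P (X @^-1` A `&` Y @^-1` B) = P (X @^-1` A) * P (Y @^-1` B)) ->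
  measurable_fun setT f -> (forall z, 0 <= f z) ->
  \int[P]_w f (X w, Y w) = \int[P]_w \int[P]_w' f (X w, Y w').
Proof.
move=> mX mY XY mf f0.
pose X' : {RV P >-> S} := HB.pack X (isMeasurableFun.Build _ _ _ _ _ mX).
pose Y' : {RV P >-> E} := HB.pack Y (isMeasurableFun.Build _ _ _ _ _ mY).
have mXY : measurable_fun setT (fun w => (X w, Y w)) by exact: measurable_fun_pair.
pose XY' : {RV P >-> (S * E)%type} := HB.pack (fun w => (X w, Y w))
  (isMeasurableFun.Build _ _ _ _ _ mXY).
transitivity (\int[distribution P XY']_z f z).
  by rewrite ge0_integral_distribution.
transitivity (\int[distribution P X' \x distribution P Y']_z f z).
  apply: eq_measure_integral => A mA _; apply/esym.
  exact: product_measure_unique.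
rewrite fubini_tonelli1// ge0_integral_distribution//; last 2 first.
- exact: measurable_fun_fubini_tonelli_F.
- by move=> y; exact: integral_ge0.
apply: eq_integral => w _ /=; rewrite /fubini_F.
rewrite ge0_integral_distribution//.
exact: measurableT_comp.
Qed.

Lemma measurable_fun_integral2 d1 d2 (S : measurableType d1) (E : measurableType d2)
    (Y : T -> E) (f : S * E -> \bar R) :
  measurable_fun setT Y -> measurable_fun setT f -> (forall z, 0 <= f z) ->
  measurable_fun setT (fun s => \int[P]_w f (s, Y w)).
Proof.
move=> mY mf f0.
apply: (@measurable_fun_fubini_tonelli_F _ _ _ _ _ P (fun z => f (z.1, Y z.2))) => //.
apply: (measurableT_comp mf); apply: measurable_fun_pair => //.
exact: measurableT_comp.
Qed.

End independent_integral.

Section history.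
Context d d0 dE (T : measurableType d) (S0 : measurableType d0) (E : measurableType dE).
Variables (V0 : T -> S0) (xi : nat -> T -> E).
Hypotheses (mV0 : measurable_fun setT V0) (mxi : forall k, measurable_fun setT (xi k)).

(** [V0] belongs to the past from time 0 on, because the length of a block depends on it. Rectangles
    form a pi-system, so measures that agree on them agree on all of [history k]. *)
Definition history_gen (k : nat) : set (set T) := [set F | exists U (D : nat -> set E),
  [/\ measurable U, forall i, measurable (D i) &
      F = V0 @^-1` U `&` \bigcap_(i in [set` iota 0 k]) (xi i @^-1` D i)]].

(* T with the sigma-algebra generated by V0 and xi 0, ..., xi (k - 1) *)
Definition history (k : nat) := g_sigma_algebraType (history_gen k).

HB.instance Definition _ k := Measurable.on (history k).

Lemma in_iota0 k i : [set` iota 0 k] i <-> (i < k)%N.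
Proof. by rewrite -[[set` _] i]/(is_true (i \in iota 0 k)) mem_iota add0n. Qed.

Lemma history_genT k : history_gen k setT.
Proof.
exists setT, (fun=> setT); split => //.
by rewrite preimage_setT setTI; apply/esym; apply: bigcapT.
Qed.

Lemma history_genI k : setI_closed (history_gen k).
Proof.
move=> _ _ [U [D [mU mD ->]]] [U' [D' [mU' mD' ->]]].
exists (U `&` U'), (fun i => D i `&` D' i); split.
- exact: measurableI.
- by move=> i; exact: measurableI.
- by rewrite preimage_setI setIACA -bigcapI.
Qed.

Lemma history_gen_measurable k : history_gen k `<=` measurable.
Proof.
move=> _ [U [D [mU mD ->]]]; apply: measurableI.
  by rewrite -[X in measurable X]setTI; exact: mV0.
apply: fin_bigcap_measurable; first exact: finite_seq.
by move=> i _; rewrite -[X in measurable X]setTI; exact: mxi.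
Qed.

Lemma history_gen_le k : history_gen k `<=` history_gen k.+1.
Proof.
move=> _ [U [D [mU mD ->]]].
exists U, (fun i => if (i < k)%N then D i else setT); split => //.
  by move=> i; case: ifP.
congr (_ `&` _); apply/seteqP; split => w h i /in_iota0 ik.
  by rewrite /=; case: ifPn => // ik'; apply: h; apply/in_iota0.
suff /h : [set` iota 0 k.+1] i by rewrite /= ik.
by apply/in_iota0; exact: ltnW.
Qed.

Lemma history_measurable k (F : set T) :
  measurable (F : set (history k)) -> measurable F.
Proof.
by apply: smallest_sub; [exact: sigma_algebra_measurable|exact: history_gen_measurable].
Qed.

Lemma history_le k l (F : set T) : (k <= l)%N ->
  measurable (F : set (history k)) -> measurable (F : set (history l)).
Proof.
move=> /subnKC <-; elim: (l - k)%N => [|m ih] mF; first by rewrite addn0.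
rewrite addnS; have := ih mF; apply: sub_smallest2r; first exact: smallest_sigma_algebra.
exact: history_gen_le.
Qed.

Lemma measurable_history_fun k d' (S : measurableType d') (f : T -> S) :
  measurable_fun setT (f : history k -> S) -> measurable_fun setT f.
Proof.
move=> mf _ Y mY; rewrite setTI; apply: (@history_measurable k).
by rewrite -[X in measurable X]setTI; exact: mf.
Qed.

Lemma history_fun_le k l d' (S : measurableType d') (f : T -> S) : (k <= l)%N ->
  measurable_fun setT (f : history k -> S) -> measurable_fun setT (f : history l -> S).
Proof.
move=> kl mf _ Y mY; rewrite setTI; apply: (history_le kl).
by rewrite -[X in measurable X]setTI; exact: mf.
Qed.

Lemma history_V0 k : measurable_fun setT (V0 : history k -> S0).
Proof.
move=> _ Y mY; apply: sub_sigma_algebra.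
exists Y, (fun=> setT); split => //.
by rewrite setTI (_ : \bigcap_(_ in _) _ = setT) ?setIT//; exact: bigcapT.
Qed.

Lemma history_xi k i : (i < k)%N -> measurable_fun setT (xi i : history k -> E).
Proof.
move=> ik _ Y mY; apply: sub_sigma_algebra.
exists setT, (fun j => if j == i then Y else setT); split => //.
  by move=> j; case: ifP.
rewrite setTI preimage_setT setTI; apply/seteqP; split => w /=.
  by move=> h j _ /=; case: eqP => [->|].
by move=> /(_ i) /=; rewrite eqxx mem_iota add0n ik; apply.
Qed.

Context (R : realType) (P : probability T R).
Local Open Scope ereal_scope.
Hypotheses (h_indep : mutually_independent P xi)
  (h_id : identically_distributed P xi)
  (h_V0 : independent_of_sequence P V0 xi).

Let xi_sigma k (D : nat -> set E) : (forall i, measurable (D i)) ->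
  <<s \bigcup_i g_sigma_algebra_preimage (xi i) >>
    (\bigcap_(i in [set` iota 0 k]) (xi i @^-1` D i)).
Proof.
move=> mD.
apply: (@fin_bigcap_measurable _
  (g_sigma_algebraType (\bigcup_i g_sigma_algebra_preimage (xi i)))).
  exact: finite_seq.
move=> i _; apply: sub_sigma_algebra; exists i => //.
by exists (D i) => //; rewrite setTI.
Qed.

(** For fixed [D] both sides are finite measures in [F]; by uniqueness it is enough to compare them
    on the generating rectangles. *)
Lemma history_indep k (F : set T) (D : set E) :
  measurable (F : set (history k)) -> measurable D ->
  P (F `&` xi k @^-1` D) = P F * P (xi k @^-1` D).
Proof.
move=> mF mD.
have mk : measurable (xi k @^-1` D) by rewrite -[X in measurable X]setTI; exact: mxi.
have [c c0 cE] : exists2 c : R, (0 <= c)%R & c%:E = P (xi k @^-1` D).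
  exists (fine (P (xi k @^-1` D))); first exact: fine_ge0.
  by rewrite fineK// fin_num_measure.
have := @g_sigma_algebra_measure_unique _ R T (history_gen k)
  (@history_gen_measurable k) (fun=> setT) (fun=> @history_genT k) _
  (mrestr P mk) (mscale (NngNum c0) P) (@history_genI k).
rewrite [in X in _ -> X]muleC -cE; apply => //.
- by rewrite bigcup_const.
- move=> _ [U [D' [mU mD' ->]]]; rewrite /mrestr.
  transitivity (c%:E * P (V0 @^-1` U `&` \bigcap_(i in [set` iota 0 k]) (xi i @^-1` D' i))) => //.
  rewrite cE.
  (* Placing [D] at coordinate k turns the intersection into a rectangle over k + 1 coordinates, to
     which the joint independence applies. *)
  pose D2 i := if i == k then D else D' i.
  have mD2 i : measurable (D2 i) by rewrite /D2; case: ifP.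
  have E1 : \bigcap_(i in [set` iota 0 k]) (xi i @^-1` D' i) =
            \bigcap_(i in [set` iota 0 k]) (xi i @^-1` D2 i).
    apply: eq_bigcapr => i /=; rewrite mem_iota add0n /D2 => ik.
    by rewrite ltn_eqF.
  have E2 : \bigcap_(i in [set` iota 0 k]) (xi i @^-1` D2 i) `&` xi k @^-1` D =
            \bigcap_(i in [set` iota 0 k.+1]) (xi i @^-1` D2 i).
    rewrite -[in iota _ k.+1]addn1 iotaD add0n /=.
    apply/seteqP; split => w /=.
      move=> [h hk] i /=; rewrite mem_cat inE => /orP[/h//|/eqP ->].
      by rewrite /D2 eqxx.
    move=> h; split; first by move=> i /= ik; apply: h => /=; rewrite mem_cat ik.
    have := h k; rewrite /= mem_cat inE eqxx orbT /D2 eqxx; exact.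
  have hV m : P (V0 @^-1` U `&` \bigcap_(i in [set` iota 0 m]) (xi i @^-1` D2 i)) =
      P (V0 @^-1` U) * (\prod_(i <- iota 0 m) P (xi i @^-1` D2 i)).
    rewrite h_V0 ?h_indep ?iota_uniq//; last exact: xi_sigma.
    by exists U => //; rewrite setTI.
  rewrite E1; transitivity (P (V0 @^-1` U `&`
    (\bigcap_(i in [set` iota 0 k]) (xi i @^-1` D2 i) `&` xi k @^-1` D))).
    by rewrite setIA.
  rewrite E2 !hV -[in iota _ k.+1]addn1 iotaD add0n /= big_cat big_seq1/=.
  by rewrite /D2 eqxx muleA muleC.
- by move=> _; apply: le_lt_trans (probability_le1 P _) (ltry _); exact: measurableI.
Qed.

(** Freezing of the past: the identity map into [history k] is treated as a random variable
    independent of [xi k]. Replacing [xi k] by [xi 0] makes the transition kernel the same at all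
    times. *)
Lemma ge0_integral_history k (f : history k * E -> \bar R) :
  measurable_fun setT f -> (forall z, 0 <= f z) ->
  \int[P]_w f (w, xi k w) = \int[P]_w \int[P]_w' f (w, xi 0%N w').
Proof.
move=> mf f0.
rewrite (@ge0_integral_indep _ _ _ P _ _ (history k) E (fun w => w) (xi k))//.
- apply: eq_integral => w _.
  have mw : measurable_fun setT (fun e => f (w : history k, e)).
    exact: measurable_fun_pair2.
  pose X i : {RV P >-> E} := HB.pack (xi i) (isMeasurableFun.Build _ _ _ _ _ (mxi i)).
  rewrite -(@ge0_integral_distribution _ _ _ _ _ P (X k) (fun e => f (w, e)))//.
  rewrite -(@ge0_integral_distribution _ _ _ _ _ P (X 0%N) (fun e => f (w, e)))//.
  by apply: eq_measure_integral => A mA _; exact: h_id.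
- by move=> _ Y mY; rewrite setTI; exact: (@history_measurable k).
- by move=> A B mA mB; exact: history_indep.
Qed.

Section markov.
Context dS (S : measurableType dS).
Variable step : S * E -> S.
Hypothesis mstep : measurable_fun setT step.
Variable psi : S -> \bar R.
Hypotheses (mpsi : measurable_fun setT psi) (psi0 : forall z, 0 <= psi z).

(** The recursion consumes the first innovation first, in step with [kernel_iter]; [runSr] gives the
    other end, needed for measurability with respect to the past. *)
Fixpoint run (k N : nat) (z : S) (w : T) : S :=
  if N is N'.+1 then run k.+1 N' (step (z, xi k w)) w else z.

Lemma runSr k N z w : run k N.+1 z w = step (run k N z w, xi (k + N)%N w).
Proof.
elim: N k z => [|N ih] k z; first by rewrite /= addn0.
by rewrite -addSnnS -[RHS]/(step (run k.+1 N _ w, _)) -ih.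
Qed.

Lemma history_run k N (Z : T -> S) : measurable_fun setT (Z : history k -> S) ->
  measurable_fun setT ((fun w => run k N (Z w) w) : history (k + N) -> S).
Proof.
move=> mZ; elim: N => [|N ih]; first by rewrite addn0.
rewrite addnS; under eq_fun do rewrite runSr.
apply: (measurableT_comp mstep); apply: measurable_fun_pair.
  exact: (history_fun_le (leqnSn _)).
exact: history_xi.
Qed.

(** The N-th power of the Markov operator of the chain, applied to [psi]. *)
Fixpoint kernel_iter (N : nat) : S -> \bar R :=
  if N is N'.+1 then fun z => \int[P]_w kernel_iter N' (step (z, xi 0%N w)) else psi.

Lemma kernel_iter_ge0 N z : 0 <= kernel_iter N z.
Proof. by elim: N z => [|N ih] z //=; apply: integral_ge0 => w _; exact: ih. Qed.

Lemma measurable_kernel_iter N : measurable_fun setT (kernel_iter N).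
Proof.
elim: N => [//|N ih] /=.
apply: (@measurable_fun_integral2 _ _ _ P _ _ S E (xi 0%N)
  (fun z => kernel_iter N (step z))) => //.
- exact: measurableT_comp.
- by move=> z; exact: kernel_iter_ge0.
Qed.

(** The Markov property at time k on an event of the past. The induction starts the remaining run
    one step later, over the larger history, and then freezes that step. *)
Lemma integral_run k N (Z : T -> S) (F : set T) :
  measurable (F : set (history k)) ->
  measurable_fun setT (Z : history k -> S) ->
  \int[P]_(w in F) psi (run k N (Z w) w) = \int[P]_(w in F) kernel_iter N (Z w).
Proof.
elim: N k Z F => [//|N ih] k Z F mF mZ /=.
have mF' := history_measurable mF.
rewrite (ih k.+1 (fun w => step (Z w, xi k w)) F); last 2 first.
- by apply: history_le mF.
- apply: (measurableT_comp mstep); apply: measurable_fun_pair.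
    exact: history_fun_le mZ.
  exact: history_xi.
pose f (z : history k * E) := (\1_F z.1)%:E * kernel_iter N (step (Z z.1, z.2)).
have mf : measurable_fun setT f.
  apply: emeasurable_funM.
    apply/measurable_EFinP; apply: (@measurableT_comp _ _ _ _ _ _ (\1_F : history k -> R)) => //.
  apply: (measurableT_comp (measurable_kernel_iter N)).
  apply: (measurableT_comp mstep); apply: measurable_fun_pair => //.
  exact: measurableT_comp.
have f0 z : 0 <= f z by rewrite mule_ge0 ?kernel_iter_ge0// lee_fin indicE.
transitivity (\int[P]_w f (w, xi k w)).
  rewrite integral_mkcond; apply: eq_integral => w _.
  by rewrite /f /= patchE indicE; case: ifP => _; rewrite ?mul1e ?mul0e.
rewrite ge0_integral_history// [RHS]integral_mkcond; apply: eq_integral => w _.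
rewrite /f /= patchE indicE; case: ifP => _.
  by apply: eq_integral => w' _; rewrite mul1e.
by rewrite integral0_eq// => w' _; rewrite mul0e.
Qed.

End markov.

End history.

(** * Estimates along one block *)

Section deterministic.
Context {R : realType} {T : Type} {n : nat}.
Variables (A : nat -> T -> 'M[R]_n.+1) (B : nat -> T -> 'cV[R]_n.+1).
Variable V0 : T -> projspace R n.

Fixpoint pwalk (k : nat) (w : T) : projspace R n :=
  if k is k'.+1 then pmove (A k' w) (pwalk k' w) else V0 w.

(** With indices starting at 1, this is A_{k+j} ... A_{k+1}. *)
Definition mxblock (k j : nat) (w : T) : 'M[R]_n.+1 :=
  mxprods (fun i => A (k + i)%N) j w.

Lemma mxprodsD k j w : mxprods A (k + j) w = mxblock k j w *m mxprods A k w.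
Proof.
rewrite /mxblock; elim: j => [|j ih] /=; first by rewrite addn0 mul1mx.
by rewrite addnS /= ih mulmxA.
Qed.

Lemma mxblock0 j w : mxblock 0 j w = mxprods A j w.
Proof. by elim: j => //= j ih; rewrite -ih. Qed.

Lemma pclass_pwalk k w : mxprods A k w *m prep (V0 w) != 0 ->
  pclass (mxprods A k w *m prep (V0 w)) = Some (pwalk k w).
Proof.
elim: k => [|k ih] /=; first by rewrite mul1mx pclass_prep.
rewrite -mulmxA => h.
have h' : mxprods A k w *m prep (V0 w) != 0.
  by apply: contraNneq h => ->; rewrite mulmx0.
rewrite -pactE ih// /pmove; have [v] := pclass_neq0 h.
by rewrite -pactE ih// => ->.
Qed.

(** The cocycle identity for gains. Positivity guarantees that [pwalk] follows the true direction up
    to time k and has not met the default value of [pmove]. *)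
Lemma pgain_mxblock k j w : 0 < pgain (mxprods A k w) (V0 w) ->
  pgain (mxblock k j w) (pwalk k w) =
  pgain (mxprods A (k + j) w) (V0 w) / pgain (mxprods A k w) (V0 w).
Proof.
move=> h.
have h0 : mxprods A k w *m prep (V0 w) != 0 by rewrite -pgain_eq0 gt_eqF.
rewrite (pgainE _ (pclass_pwalk h0)) mxprodsD /pgain mulmxA.
by field; rewrite !enorm_eq0 h0 prep_neq0.
Qed.

Lemma affine_rec_expand x k w : affine_rec A B x k w = mxprods A k w *m x +
  \sum_(i < k) mxblock i.+1 (k - i.+1) w *m B i w.
Proof.
elim: k => [|k ih] /=; first by rewrite big_ord0 mul1mx addr0.
rewrite ih mulmxDr mulmxA -addrA; congr (_ + _).
rewrite mulmx_sumr big_ord_recr/= subnn [mxblock _ 0 _]/= mul1mx; congr (_ + _).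
apply: eq_bigr => i _; rewrite mulmxA; congr (_ *m _).
by rewrite subSn// /mxblock /= subnKC.
Qed.

Lemma enorm_affine_rec x k w : enorm (affine_rec A B x k w) <=
  opnorm (mxprods A k w) * enorm x +
  \sum_(i < k) opnorm (mxblock i.+1 (k - i.+1) w) * enorm (B i w).
Proof.
rewrite affine_rec_expand (le_trans (enormD _ _))// lerD ?enorm_mulmx//.
rewrite (le_trans (enorm_sum _ _))//.
by apply: ler_sum => i _; exact: enorm_mulmx.
Qed.

Lemma opnorm1 : opnorm (1%:M : 'M[R]_n.+1) = 1.
Proof.
rewrite /opnorm (_ : [set _ | _ in _] = [set 1]) ?sup1//.
apply/seteqP; split => [_ [x /= x1 <-]|_ ->] /=; first by rewrite mul1mx.
have [[_ [x /= x1 _]] _] := @opnorm_has_sup R n 1%:M.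
by exists x => //; rewrite mul1mx.
Qed.

Lemma lnep_ge0 (x : \bar R) : (0 <= lnep x)%E.
Proof. by rewrite /lnep le_max lexx orbT. Qed.

Lemma lnep_EFin (r : R) : lnep r%:E = (Num.max (ln r) 0)%:E.
Proof.
rewrite /lnep EFin_max; have [r0|r0] := leP r 0; last by rewrite lne_EFin.
by rewrite le0_lneNy// ln0//= maxxx; apply/max_idPr.
Qed.

Lemma le_lnep : {homo @lnep R : x y / (x <= y)%E}.
Proof.
move=> x y xy; have [x0|x0] := leP x 0%E.
  by rewrite {1}/lnep le0_lneNy//= (_ : maxe -oo 0 = 0)%E ?lnep_ge0//; apply/max_idPr.
rewrite /lnep ge_max !le_max lexx orbT andbT.
by rewrite lee_lne ?xy// in_itv/= leey andbT ltW// (lt_le_trans x0).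
Qed.

(* With the conventions of eratio, a finite bound forces o = 0 when p = 0. *)
Lemma eratio_le (o p y : R) : 0 <= o -> 0 <= p ->
  (lnep (eratio o p) <= y%:E)%E -> o <= expR y * p.
Proof.
move=> o0 p0; rewrite /eratio /lnep.
have [->|pN0] := eqVneq p 0.
  by have [->|oN0] := eqVneq o 0; [rewrite mulr0|rewrite /= ge_max].
have pp : 0 < p by rewrite lt_def pN0.
rewrite ge_max => /andP[+ _].
have [->|oN0] := eqVneq o 0; first by rewrite mulr_ge0 ?expR_ge0.
have op : 0 < o / p by rewrite divr_gt0// lt_def oN0.
rewrite lne_EFin// lee_fin => h.
by rewrite -ler_pdivrMr// -[leLHS]lnK ?posrE// ler_expR.
Qed.

(** If c > t then (c / t)^(b - 1) >= 1, so the second term alone is at least c. *)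
Lemma powR_young (c t b : R) : 0 <= c -> 0 < t -> 1 <= b ->
  c <= t + c `^ b * t `^ (- (b - 1)).
Proof.
move=> c0 t0 b1; have [ct|tc] := leP c t.
  by rewrite (le_trans ct)// lerDl mulr_ge0// powR_ge0.
have cp : 0 < c by exact: lt_trans tc.
apply: le_trans (_ : c `^ b * t `^ (- (b - 1)) <= _); last by rewrite lerDr ltW.
rewrite powRN ler_pdivlMr ?powR_gt0//.
rewrite -[leRHS]mulr_powRB1// ?(lt_le_trans _ b1)// ler_wpM2l//.
by rewrite ge0_ler_powR ?nnegrE ?subr_ge0// ?(ltW t0) ?(ltW tc).
Qed.

Lemma le_lne_moment (r : \bar R) (t b g : R) : 0 < t -> 1 <= b ->
  (lnep r `^ b <= g%:E)%E -> (lnep r <= (t + g * t `^ (- (b - 1)))%:E)%E.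
Proof.
move=> t0 b1; have b0 : 0 < b by rewrite (lt_le_trans _ b1).
have := lnep_ge0 r; case: (lnep r) => [c| |]//=; rewrite ?lee_fin; last first.
  by rewrite gt_eqF.
move=> c0 cg; apply: (le_trans (powR_young c0 t0 b1)).
by rewrite lerD2l ler_wpM2r ?powR_ge0.
Qed.

(** A form of ln (k^a) <= k^a. It puts the number of summands of the translation part on the same
    exponential scale k^alpha as their size. *)
Lemma nat_le_expR (a : R) (k : nat) : 0 < a -> k%:R <= expR (a^-1 * k%:R `^ a).
Proof.
move=> a0; case: k => [|k]; first by rewrite expR_ge0.
have kp : 0 < k.+1%:R :> R by [].
rewrite -[leLHS]lnK ?posrE// ler_expR.
rewrite mulrC ler_pdivlMr// mulrC -ln_powR.
by rewrite ltW// ln_sublinear// powR_gt0.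
Qed.

Lemma enorm_stopped x k w (c rho e1 e2 : R) :
  opnorm (mxprods A k w) <= expR c * rho ->
  (forall i, (i < k)%N -> opnorm (mxblock i.+1 (k - i.+1) w) <= expR e1) ->
  (forall i, (i < k)%N -> enorm (B i w) <= expR e2) ->
  enorm (affine_rec A B x k w) <=
    expR c * rho * enorm x + k%:R * expR (e1 + e2).
Proof.
move=> h0 h1 h2; rewrite (le_trans (enorm_affine_rec _ _ _))// lerD//.
  by rewrite ler_wpM2r// enorm_ge0.
rewrite expRD mulr_natl -[k in _ *+ k]card_ord -sumr_const; apply: ler_sum => i _.
by rewrite ler_pM ?opnorm_ge0 ?enorm_ge0 ?h1 ?h2.
Qed.

(** The linear part changes the logarithm by c - L. The translation part, at most [expR e], is
    weighed against 1 + y > 1 + K, which yields the factor [(1 + K)^-1] that a large K makes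
    harmless. *)
Lemma ln_stopped (c L e K y N z : R) : 0 <= c -> 0 <= L -> 0 < K -> K < y -> N <= expR e ->
  0 <= e -> 0 <= z -> z <= expR (c - L) * y + N ->
  ln (1 + z) + L <= ln (1 + y) + c + ln (1 + (1 + K)^-1 * expR (e + 1 + L)).
Proof.
move=> c0 L0 K0 Ky Ne e0 z0 zN.
have y0 : 0 < y by rewrite (lt_trans K0).
have K1 : 0 < 1 + K by rewrite addr_gt0.
set s := _^-1 * _.
have s0 : 0 < s by rewrite mulr_gt0 ?invr_gt0 ?expR_gt0.
have -> : ln (1 + y) + c + ln (1 + s) = ln ((1 + y) * expR (c - L) * (1 + s)) + L.
  rewrite !lnM ?posrE ?mulr_gt0 ?expR_gt0 ?addr_gt0// expRK; ring.
rewrite lerD2r ler_ln ?posrE ?(ltr_pwDl ltr01 z0) ?mulr_gt0 ?expR_gt0 ?(addr_gt0 ltr01)//.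
rewrite mulrDr mulr1.
(* The shift [e + 1] absorbs 1 + N <= 2 exp(e) <= exp(e + 1), and the [L] in [s] cancels the
   contraction exp(- L). *)
have key : 1 + N <= (1 + y) * expR (c - L) * s.
  apply: (@le_trans _ _ (expR (e + 1))).
    have e1 : 1 <= expR e by rewrite -expR0 ler_expR.
    have e2 : 2 <= expR 1 :> R by exact: expR_ge1Dx.
    rewrite expRD; nra.
  have -> : (1 + y) * expR (c - L) * s = expR (e + 1 + c) * ((1 + y) / (1 + K)).
    rewrite (_ : e + 1 + c = (c - L) + (e + 1 + L)); last by ring.
    by rewrite (expRD (c - L) (e + 1 + L)) /s; field; rewrite gt_eqF.
  rewrite -[leLHS]mulr1 ler_pM ?expR_ge0//.
    by rewrite ler_expR lerDl.
  by rewrite ler_pdivlMr// mul1r lerD2l ltW.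
rewrite mulrDl mul1r.
have := expR_ge0 (c - L); lra.
Qed.

End deterministic.

Section series_estimates.
Context {R : realType}.

Lemma riemann_sum_le (p : R) (N : nat) : 1 < p ->
  \sum_(0 <= i < N) i.+1%:R `^ (- p) <= p / (p - 1).
Proof.
move=> p1; have q0 : 0 < p - 1 by rewrite subr_gt0.
case: N => [|N].
  by rewrite big_geq// divr_ge0 ?ltW// (lt_trans ltr01).
(* Comparison with the integral of t^(-p) from 1 to N + 1, which telescopes; the limit p / (p - 1)
   is 1 + 1 / (p - 1). *)
suff : \sum_(0 <= i < N.+1) i.+1%:R `^ (- p) <= (p - N.+1%:R `^ (1 - p)) / (p - 1).
  by move=> /le_trans; apply; rewrite ler_pM2r ?invr_gt0// gerBl powR_ge0.
elim: N => [|N ih].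
  by rewrite big_nat1 !powR1 divff// gt_eqF.
rewrite big_nat_recr//= (le_trans (lerD ih (lexx _)))//.
rewrite -lerBrDl -mulrBl ler_pdivlMr//.
rewrite (_ : p - _ - (_ - _) = N.+1%:R `^ (1 - p) - N.+2%:R `^ (1 - p)); last by ring.
set y : R := N.+2%:R; set x : R := N.+1%:R.
have x0 : 0 < x by rewrite ltr0n.
have y0 : 0 < y by rewrite ltr0n.
have yx : y = x + 1 by rewrite /y /x -natr1.
have lnxy : ln (x / y) <= - y^-1.
  rewrite (_ : x / y = 1 + (- y^-1)); last first.
    have -> : x = y - 1 by rewrite yx addrK.
    by field; rewrite gt_eqF.
  by apply: le_ln1Dx; rewrite ltrN2 invf_lt1// yx ltrDr.
have h : y `^ (1 - p) * (1 + (p - 1) / y) <= x `^ (1 - p).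
  rewrite (_ : x `^ (1 - p) = y `^ (1 - p) * (x / y) `^ (1 - p)).
    rewrite ler_wpM2l ?powR_ge0// (le_trans (expR_ge1Dx _))//.
    rewrite /powR gt_eqF ?divr_gt0// ler_expR.
    have := ler_wpM2l (ltW q0) lnxy.
    by rewrite mulrN -[1 - p]opprB mulNr lerNr.
  by rewrite -powRM ?ltW ?divr_gt0// mulrCA divff ?mulr1// gt_eqF.
rewrite (_ : y `^ (- p) = y `^ (1 - p) / y); last first.
  rewrite -[y in _ / y]powRr1 ?ltW// -powRB ?(gt_eqF y0) ?implybT//.
  by congr (_ `^ _); ring.
by move: h; rewrite mulrDr mulr1 => h; rewrite mulrAC -mulrA lerBrDl.
Qed.

Lemma sum_indic_le (a l y : R) (N : nat) : 0 < a -> a <= 1 ->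
  \sum_(0 <= i < N) (((i.+1%:R <= l) && (i.+1%:R < y))%:R : R) <= l `^ a * y `^ (1 - a).
Proof.
move=> a0 a1.
(* The bound by N is carried along: if the last index counts, the sum is at most N + 1, which is
   below both l and y and equals (N + 1)^a (N + 1)^(1 - a). *)
suff [//] : \sum_(0 <= i < N) (((i.+1%:R <= l) && (i.+1%:R < y))%:R : R) <=
     l `^ a * y `^ (1 - a) /\
     \sum_(0 <= i < N) (((i.+1%:R <= l) && (i.+1%:R < y))%:R : R) <= N%:R.
elim: N => [|N [ih1 ih2]].
  by rewrite big_geq//; split => //; rewrite mulr_ge0// powR_ge0.
rewrite big_nat_recr//=; split; last by rewrite -natr1 lerD// lern1; case: (_ && _).
case: (boolP (_ && _)) => [/andP[Nl Ny]|_]; last by rewrite addr0.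
apply: (@le_trans _ _ N.+1%:R); first by rewrite -natr1 lerD2r.
have -> : N.+1%:R = N.+1%:R `^ a * N.+1%:R `^ (1 - a) :> R.
  by rewrite -powRD ?pnatr_eq0 ?implybT// subrKC powRr1.
by rewrite ler_pM ?powR_ge0// ge0_ler_powR ?nnegrE ?subr_ge0 ?(ltW a0)//
  ?(le_trans _ Nl) ?(ltW Ny)// (le_trans _ (ltW Ny)).
Qed.

Local Open Scope ereal_scope.

Lemma nneseries_le (u : nat -> \bar R) (M : \bar R) : (forall i, 0 <= u i) ->
  (forall N, \sum_(0 <= i < N) u i <= M) -> \sum_(i <oo) u i <= M.
Proof.
move=> u0 uM; apply: lime_le; first exact: is_cvg_nneseries.
exact: nearW.
Qed.

Lemma le_nneseries_term (u : nat -> \bar R) k : (forall i, 0 <= u i) ->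
  u k <= \sum_(i <oo) u i.
Proof.
move=> u0; apply: le_trans (nneseries_lim_ge k.+1 _) => //.
by rewrite big_nat_recr//= leeDr// sume_ge0.
Qed.

Lemma measurable_nneseries d (T : measurableType d) (h : nat -> T -> \bar R) :
  (forall i x, 0 <= h i x) -> (forall i, measurable_fun setT (h i)) ->
  measurable_fun setT (fun x => \sum_(i <oo) h i x).
Proof.
move=> h0 mh.
apply: (emeasurable_fun_cvg (fun N x => \sum_(0 <= i < N) h i x)) => [N|x _].
  exact: emeasurable_sum.
exact: is_cvg_nneseries.
Qed.

End series_estimates.

(** * The projective walk *)

Section measurable_gain.
Context {R : realType} {n : nat}.

Lemma measurable_lnep : measurable_fun setT (@lnep R).
Proof.
rewrite (_ : @lnep R = fun x => maxe (er_map (fun r => Num.max (ln r) 0) x) 0%E).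
  have mf : measurable_fun [set: R] (fun r => Num.max (ln r) 0).
    have := @measurable_maxr _ _ R setT (@ln R) (cst 0) (@measurable_ln R).
    by apply; exact: measurable_cst.
  by apply: measurable_maxe => //; exact: (@measurable_er_map _ (measurableTypeR R) R _ mf).
apply/funext => -[r| |]//=; rewrite lnep_EFin -EFin_max; congr _%:E.
by apply/esym/max_idPl; rewrite le_max lexx orbT.
Qed.

Context d (T : measurableType d).

Lemma measurable_fun_eratio (f g : T -> R) :
  (forall t, 0 <= g t) -> measurable_fun setT f -> measurable_fun setT g ->
  measurable_fun setT (fun t => eratio (f t) (g t)).
Proof.
move=> g0 mf mg; rewrite /eratio; apply: measurable_fun_ifT.
- exact: measurable_fun_eqr.
- by apply: measurable_fun_ifT => //; exact: measurable_fun_eqr.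
- apply/measurable_EFinP; under eq_fun do rewrite -powR_inv1//.
  apply: measurable_funM => //.
  apply: (@measurableT_comp _ _ _ _ _ _ (fun x : R => x `^ (-1))) => //.
Qed.

Definition loggain (b : R) (M : 'M[R]_n.+1) (v : projspace R n) : \bar R :=
  (lnep (eratio (opnorm M) (pgain M v)) `^ b)%E.

Lemma measurable_fun_loggain b (f : T -> 'M[R]_n.+1) (h : T -> projspace R n) :
  measurable_fun setT f -> measurable_fun setT h ->
  measurable_fun setT (fun t => loggain b (f t) (h t)).
Proof.
move=> mf mh.
apply: (@measurableT_comp _ _ _ _ _ _ (fun x : \bar R => x `^ b)%E).
  exact: measurable_poweR.
apply: (measurableT_comp measurable_lnep).
apply: measurable_fun_eratio.
- by move=> t; exact: pgain_ge0.
- by apply: (measurableT_comp _ mf); exact: measurable_opnorm.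
- exact: measurable_fun_pgain.
Qed.

Lemma le_lnep_poweR (b : R) (x y : \bar R) : 0 <= b -> (x <= y)%E ->
  (lnep x `^ b <= lnep y `^ b)%E.
Proof.
move=> b0 xy; apply: gt0_ler_poweR; rewrite ?in_itv/= ?lnep_ge0 ?leey//.
exact: le_lnep.
Qed.

End measurable_gain.

Section projective_walk.
Context {R : realType} {n : nat} {disp : measure_display} {T : measurableType disp}
  {P : probability T R}.
Variables (A : nat -> {RV P >-> 'M[R]_n.+1}) (B : nat -> {RV P >-> 'cV[R]_n.+1}).
Variable V0 : {RV P >-> projspace R n}.
Local Notation xi := (fun k w => (A k w, B k w)).
Local Notation hist := (history V0 xi).
Local Notation E := ('M[R]_n.+1 * 'cV[R]_n.+1)%type.

Lemma measurable_innovation k : measurable_fun setT (xi k : T -> E).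
Proof. by apply: measurable_fun_pair; exact: measurable_funP. Qed.

Lemma history_A k l : (k < l)%N -> measurable_fun setT (A k : hist l -> 'M[R]_n.+1).
Proof.
by move=> kl; have /measurable_fun_pairP[] := @history_xi _ _ _ T _ _ V0 xi l k kl.
Qed.

Lemma history_B k l : (k < l)%N -> measurable_fun setT (B k : hist l -> 'cV[R]_n.+1).
Proof.
by move=> kl; have /measurable_fun_pairP[] := @history_xi _ _ _ T _ _ V0 xi l k kl.
Qed.

Lemma history_pwalk k : measurable_fun setT (pwalk A V0 k : hist k -> projspace R n).
Proof.
elim: k => [|k ih] /=; first exact: history_V0.
apply: measurable_fun_pmove; first exact: history_A.
exact: (history_fun_le (leqnSn k)).
Qed.

Lemma history_mxprods k : measurable_fun setT (mxprods A k : hist k -> 'M[R]_n.+1).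
Proof.
elim: k => [|k ih] /=; first exact: measurable_cst.
apply: measurable_fun_mulmx; first exact: history_A.
exact: (history_fun_le (leqnSn k)).
Qed.

Lemma history_affine_rec x k :
  measurable_fun setT (affine_rec A B x k : hist k -> 'cV[R]_n.+1).
Proof.
elim: k => [|k ih] /=; first exact: measurable_cst.
apply: measurable_fun_addmx; last exact: history_B.
apply: measurable_fun_mulmx; first exact: history_A.
exact: (history_fun_le (leqnSn k)).
Qed.

Lemma measurable_hist k d' (S : measurableType d') (f : T -> S) :
  measurable_fun setT (f : hist k -> S) -> measurable_fun setT f.
Proof. by apply: measurable_history_fun => //; exact: measurable_innovation. Qed.

Hypotheses (h_indep : mutually_independent P xi) (h_id : identically_distributed P xi)
  (h_V0_indep : independent_of_sequence P V0 xi).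
Variable nu : probability (projspace R n) R.
Hypotheses (h_inv : proj_invariant (distribution P (A 0%N)) nu)
  (h_V0 : forall U, measurable U -> distribution P V0 U = nu U).
Local Open Scope ereal_scope.

Let mfst : measurable_fun setT (@fst 'M[R]_n.+1 (projspace R n)).
Proof. exact: measurable_fst. Qed.
Let msnd : measurable_fun setT (@snd 'M[R]_n.+1 (projspace R n)).
Proof. exact: measurable_snd. Qed.

Let pact_setE (U : set (projspace R n)) :
  [set p : 'M[R]_n.+1 * projspace R n | (Some @` U) (pact p.1 (Some p.2))] =
  [set p | pgain p.1 p.2 != 0%R] `&` (fun p => pmove p.1 p.2) @^-1` U.
Proof.
apply/seteqP; split => -[a v] /=.
  move=> [u Uu uE]; split; last by rewrite /pmove /= -uE.
  by rewrite -pact_eq_none /= -uE.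
rewrite -pact_eq_none /pmove /=; case: pclass => [u|] [//=] _ Uu.
by exists u.
Qed.

Let measurable_pact_set (U : set (projspace R n)) : measurable U ->
  measurable [set p : 'M[R]_n.+1 * projspace R n | (Some @` U) (pact p.1 (Some p.2))].
Proof.
move=> mU; rewrite pact_setE; apply: measurableI.
  rewrite [X in measurable X](_ : _ =
      (fun p => pgain p.1 p.2) @^-1` (~` [set 0%R])); last first.
    by apply/seteqP; split => p /= /eqP.
  rewrite -[X in measurable X]setTI; apply: measurable_fun_pgain => //.
  exact: measurableC.
by rewrite -[X in measurable X]setTI; apply: measurable_fun_pmove.
Qed.

(** Invariance applied to the whole space says that the gain is almost surely nonzero, so the
    default value of [pmove] does not affect the law. The induction uses that [A k] is independent
    of [pwalk k], which belongs to the past. *)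
Lemma law_pwalk k (U : set (projspace R n)) : measurable U ->
  P (pwalk A V0 k @^-1` U) = nu U.
Proof.
elim: k U => [|k ih] U mU; first exact: h_V0.
have mA : measurable_fun setT (A k) by exact: measurable_funP.
have mV : measurable_fun setT (pwalk A V0 k).
  by apply: (@measurable_hist k); exact: history_pwalk.
have mAV : measurable_fun setT (fun w => (A k w, pwalk A V0 k w)).
  exact: measurable_fun_pair.
pose AV : {RV P >-> ('M[R]_n.+1 * projspace R n)%type} :=
  HB.pack (fun w => (A k w, pwalk A V0 k w)) (isMeasurableFun.Build _ _ _ _ _ mAV).
have AVE (S : set ('M[R]_n.+1 * projspace R n)) : measurable S ->
    (distribution P (A 0%N) \x nu) S = P (AV @^-1` S).
  move=> mS; rewrite (@product_measure_unique _ _ _ _ _ _ _ (distribution P AV))//.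
  move=> C D mC mD /=; rewrite -ih//.
  have mCD : measurable (C `*` setT : set E) by exact: measurableX.
  have mF : measurable (pwalk A V0 k @^-1` D : set (hist k)).
    by rewrite -[X in measurable X]setTI; exact: history_pwalk.
  have := @history_indep _ _ _ T _ _ V0 xi (measurable_funP V0) measurable_innovation R P
    h_indep h_V0_indep k _ _ mF mCD.
  have XE j : xi j @^-1` (C `*` setT) = A j @^-1` C.
    by apply/seteqP; split => w /= => [[]|].
  rewrite [RHS]muleC [X in _ = X * _](_ : _ = distribution P (A 0%N) C); last first.
    by rewrite (h_id k 0%N mCD) XE.
  by move=> <-; rewrite XE setIC.
have mAVS S : measurable S -> measurable (AV @^-1` S).
  by move=> mS; exact: (measurable_funPTI AV).
have mpg : measurable [set p : 'M[R]_n.+1 * projspace R n | pgain p.1 p.2 != 0%R].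
  by have := measurable_pact_set measurableT; rewrite pact_setE preimage_setT setIT.
have PY : P (AV @^-1` [set p | pgain p.1 p.2 != 0%R]) = 1.
  rewrite -AVE//; have := h_inv measurableT.
  by rewrite pact_setE preimage_setT setIT => ->; exact: probability_setT.
have mX : measurable (pwalk A V0 k.+1 @^-1` U).
  rewrite -[X in measurable X]setTI.
  suff : measurable_fun setT (pwalk A V0 k.+1) by apply.
  by apply: (@measurable_hist k.+1); exact: history_pwalk.
rewrite (@measureDI _ _ _ P _ (AV @^-1` [set p | pgain p.1 p.2 != 0%R]) mX); last exact: mAVS.
rewrite [X in X + _](_ : _ = 0) ?add0e.
  rewrite -(h_inv mU) AVE; last exact: measurable_pact_set.
  by congr (P _); rewrite pact_setE setIC preimage_setI.
apply/eqP; rewrite eq_le measure_ge0 andbT.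
apply: (@le_trans _ _ (P (~` (AV @^-1` [set p | pgain p.1 p.2 != 0%R])))).
  apply: le_measure; rewrite ?inE; last by move=> w [].
    by apply: measurableD => //; exact: mAVS.
  by apply: measurableC; exact: mAVS.
by rewrite probability_setC ?PY ?subee//; exact: mAVS.
Qed.

Lemma integral_pwalk k (phi : projspace R n -> \bar R) :
  measurable_fun setT phi -> (forall v, 0 <= phi v) ->
  \int[P]_w phi (pwalk A V0 k w) = \int[nu]_v phi v.
Proof.
move=> mphi phi0.
have mV : measurable_fun setT (pwalk A V0 k).
  by apply: (@measurable_hist k); exact: history_pwalk.
pose Vk : {RV P >-> projspace R n} :=
  HB.pack (pwalk A V0 k) (isMeasurableFun.Build _ _ _ _ _ mV).
rewrite -(@ge0_integral_distribution _ _ _ _ _ P Vk phi)//.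
by apply: eq_measure_integral => U mU _; exact: law_pwalk.
Qed.

Variable b : R.
Local Notation S := (projspace R n * 'M[R]_n.+1 * \bar R)%type.

(** The state holds the initial direction, which stays frozen, the product accumulated since, and
    the running maximum of the gains. The law of that maximum then depends on the starting time only
    through the law of the direction. *)
Let gstep (z : S * E) : S :=
  ((z.1.1.1, z.2.1 *m z.1.1.2), maxe z.1.2 (loggain b (z.2.1 *m z.1.1.2) z.1.1.1)).

Let mgstep : measurable_fun setT gstep.
Proof.
have mA' : measurable_fun setT (fun z : S * E => z.2.1) by exact: measurableT_comp.
have mM : measurable_fun setT (fun z : S * E => z.1.1.2).
  by apply: measurableT_comp => //; exact: measurableT_comp.
have mv : measurable_fun setT (fun z : S * E => z.1.1.1).
  by apply: measurableT_comp => //; exact: measurableT_comp.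
have mr : measurable_fun setT (fun z : S * E => z.1.2) by exact: measurableT_comp.
have mAM := measurable_fun_mulmx mA' mM.
apply: measurable_fun_pair; first exact: measurable_fun_pair.
by apply: measurable_maxe => //; exact: measurable_fun_loggain.
Qed.

Let gstart k w : S := ((pwalk A V0 k w, 1%:M), 0).
Let grun k N w := run xi gstep k N (gstart k w) w.

Let grun1 k N w : (grun k N w).1 = (pwalk A V0 k w, mxblock A k N w).
Proof.
rewrite /grun; elim: N => [//|N ih].
by rewrite runSr /gstep /= ih.
Qed.

Let grun2 k N w : (grun k N.+1 w).2 =
  maxe (grun k N w).2 (loggain b (mxblock A k N.+1 w) (pwalk A V0 k w)).
Proof.
rewrite {1}/grun runSr /gstep [LHS]/= -/(grun k N w) grun1.
by [].
Qed.

Let grun_ge0 k N w : 0 <= (grun k N w).2.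
Proof. by elim: N => [//|N ih]; rewrite grun2 le_max ih. Qed.

Let grun_nd k w : nondecreasing_seq (fun N => (grun k N w).2).
Proof. by apply/nondecreasing_seqP => N; rewrite grun2 le_max lexx. Qed.

Let history_gstart k : measurable_fun setT (gstart k : hist k -> S).
Proof.
apply: measurable_fun_pair => //; apply: measurable_fun_pair => //.
exact: history_pwalk.
Qed.

Let measurable_grun k N : measurable_fun setT (grun k N).
Proof. by apply: (@measurable_hist (k + N)); apply: history_run. Qed.

(** The truncation at 0 makes [psi] nonnegative on the whole state space, as [integral_run]
    requires; along the runs it changes nothing. *)
Let psi (z : S) : \bar R := maxe z.2 0.
Let mpsi : measurable_fun setT psi.
Proof. by apply: measurable_maxe. Qed.
Let psi0 z : 0 <= psi z.
Proof. by rewrite /psi le_max lexx orbT. Qed.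

(** Both sides are the nu-integral of one iterated kernel, since [pwalk k] and [V0] have the same
    law. *)
Let integral_grun k N : \int[P]_w (grun k N w).2 = \int[P]_w (grun 0 N w).2.
Proof.
have key l : \int[P]_w (grun l N w).2 =
    \int[nu]_v kernel_iter xi P gstep psi N ((v, 1%:M), 0).
  transitivity (\int[P]_(w in setT) psi (run xi gstep l N (gstart l w) w)).
    by apply: eq_integral => w _; apply/esym/max_idPl; exact: grun_ge0.
  rewrite (@integral_run _ _ _ T _ _ V0 xi _ measurable_innovation R P h_indep h_id
    h_V0_indep _ S gstep mgstep psi mpsi psi0 l N (gstart l) setT) //.
  rewrite -(@integral_pwalk l (fun v => kernel_iter xi P gstep psi N ((v, 1%:M), 0)))//.
    apply: (@measurableT_comp _ _ _ _ _ _ (kernel_iter xi P gstep psi N)).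
      by apply: measurable_kernel_iter => // j; exact: measurable_innovation.
    by apply: measurable_fun_pair => //; exact: measurable_fun_pair.
  by move=> v; exact: kernel_iter_ge0.
by rewrite !key.
Qed.

Lemma measurable_C1 : measurable_fun setT (fun w => C1 A (V0 w) w).
Proof.
rewrite (_ : (fun _ => _) = fun w => esups (fun k =>
    eratio (opnorm (mxprods A k w)) (pgain (mxprods A k w) (V0 w))) 1%N) //.
have mM k : measurable_fun setT (mxprods A k).
  by apply: (@measurable_hist k); exact: history_mxprods.
have mV : measurable_fun setT V0 by exact: measurable_funP.
apply: (@measurable_fun_esups _ _ _ setT (fun k w =>
    eratio (opnorm (mxprods A k w)) (pgain (mxprods A k w) (V0 w)))) => k.
apply: measurable_fun_eratio.
- by move=> t; exact: pgain_ge0.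
- by apply: (@measurableT_comp _ _ _ _ _ _ (@opnorm R n.+1)) => //; exact: measurable_opnorm.
- exact: measurable_fun_pgain.
Qed.

Lemma loggain_le_C1 j w : (0 <= b)%R -> (0 < j)%N ->
  loggain b (mxprods A j w) (V0 w) <= lnep (C1 A (V0 w) w) `^ b.
Proof.
move=> b0 j0; apply: le_lnep_poweR => //.
by apply: ereal_sup_ubound; exists j.
Qed.

(* The bound on the means is uniform in k because nu is invariant. *)
Lemma loggain_majorant : (0 <= b)%R -> exists G : nat -> T -> \bar R,
  [/\ forall k, measurable_fun setT (G k), forall k w, 0 <= G k w,
      forall k, \int[P]_w G k w <= \int[P]_w (lnep (C1 A (V0 w) w) `^ b)
    & forall k j w, (0 < j)%N ->
        loggain b (mxblock A k j w) (pwalk A V0 k w) <= G k w].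
Proof.
(* [G k] is the supremum of the gains of all blocks starting at k. For k = 0 the running maxima lie
   below C_1; equality of means transfers the bound to other k, and monotone convergence removes the
   horizon. *)
move=> b0; exists (fun k w => limn (fun N => (grun k N w).2)).
have mg k N : measurable_fun setT (fun w => (grun k N w).2).
  by apply: (@measurableT_comp _ _ _ _ _ _ (@snd _ (\bar R))) => //; exact: measurable_grun.
have cg k w : cvgn (fun N => (grun k N w).2).
  by apply: ereal_nondecreasing_is_cvgn; exact: grun_nd.
have leG k N w : (grun k N w).2 <= limn (fun N => (grun k N w).2).
  apply: lime_ge => //; near=> m; apply: grun_nd; near: m; exact: nbhs_infty_ge.
split.
- by move=> k; apply: (emeasurable_fun_cvg (fun N w => (grun k N w).2)) => // w _; exact: cg.
- by move=> k w; apply: le_trans (leG k 0%N w).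
- move=> k; rewrite monotone_convergence//.
  apply: lime_le.
    apply: ereal_nondecreasing_is_cvgn => p q pq; apply: ge0_le_integral => //.
    by move=> w _; exact: grun_nd.
  apply: nearW => N; rewrite integral_grun; apply: ge0_le_integral => //.
    apply: (@measurableT_comp _ _ _ _ _ _ (fun x : \bar R => x `^ b)).
      exact: measurable_poweR.
    apply: (measurableT_comp measurable_lnep); exact: measurable_C1.
  move=> w _; elim: N => [|N ih]; first exact: poweR_ge0.
  by rewrite grun2 ge_max ih mxblock0; exact: (@loggain_le_C1 N.+1).
- move=> k [//|j] w _; apply: le_trans (leG k j.+1 w).
  by rewrite grun2 le_max lexx orbT.
Unshelve. all: by end_near.
Qed.

End projective_walk.

(** * Survival outside a ball and the stopped block *)

Lemma indic_natr (R : realType) (T : Type) (D : set T) (b : bool) (w : T) :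
  (D w <-> b) -> \1_D w = b%:R :> R.
Proof.
move=> Db; rewrite indicE; congr (nat_of_bool _)%:R; apply/idP/idP; first by move=> /set_mem/Db.
by move=> /Db/mem_set.
Qed.

Section survival.
Context {R : realType} {n : nat} {disp : measure_display} {T : measurableType disp}
  {P : probability T R}.
Variables (A : nat -> {RV P >-> 'M[R]_n.+1}) (B : nat -> {RV P >-> 'cV[R]_n.+1}).
Variable V0 : {RV P >-> projspace R n}.
Local Notation xi := (fun k w => (A k w, B k w)).
Local Notation hist := (history V0 xi).
Local Notation E := ('M[R]_n.+1 * 'cV[R]_n.+1)%type.
Local Notation X := (affine_rec A B).
Local Open Scope ereal_scope.
Hypotheses (h_indep : mutually_independent P xi) (h_id : identically_distributed P xi)
  (h_V0_indep : independent_of_sequence P V0 xi).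
Variable K : R.

Definition stays_out (k : nat) (x : 'cV[R]_n.+1) : set T :=
  [set w | forall j, (k <= j)%N -> (K < enorm (X x j w))%R].

Let stays_outN (k N : nat) (x : 'cV[R]_n.+1) : set T :=
  [set w | forall j, (k <= j <= k + N)%N -> (K < enorm (X x j w))%R].

Let stays_outE k x : stays_out k x = \bigcap_N stays_outN k N x.
Proof.
apply/seteqP; split => w h; first by move=> N _ j /andP[kj _]; exact: h.
by move=> j kj; apply: (h j) => //; rewrite kj leq_addl.
Qed.

Let stays_outN0 k x : stays_outN k 0 x = [set w | (K < enorm (X x k w))%R].
Proof.
apply/seteqP; split => w; first by apply; rewrite addn0 leqnn.
by move=> h j; rewrite addn0 -eqn_leq => /eqP <-.
Qed.

Let stays_outNS k N x : stays_outN k N.+1 x =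
  stays_outN k N x `&` [set w | (K < enorm (X x (k + N.+1) w))%R].
Proof.
apply/seteqP; split => w /=.
  move=> h; split; last by apply: h; rewrite leq_addr leqnn.
  by move=> j /andP[kj jN]; apply: h; rewrite kj (leq_trans jN)// leq_add2l.
move=> [h1 h2] j /andP[kj]; rewrite leq_eqVlt => /orP[/eqP -> //|].
by rewrite addnS ltnS => jN; apply: h1; rewrite kj.
Qed.

Let mX x k : measurable_fun setT (X x k).
Proof. by apply: (@measurable_hist _ _ _ _ _ A B V0 k); exact: history_affine_rec. Qed.

Let mout x k : measurable [set w | (K < enorm (X x k w))%R].
Proof.
rewrite [X in measurable X](_ : _ = (fun w => enorm (X x k w)) @^-1` `]K, +oo[); last first.
  by apply/seteqP; split => w /=; rewrite in_itv/= andbT.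
by rewrite -[X in measurable X]setTI; apply: measurable_fun_enorm.
Qed.

Let mstays_outN k N x : measurable (stays_outN k N x).
Proof.
elim: N => [|N ih]; first by rewrite stays_outN0.
by rewrite stays_outNS; exact: measurableI.
Qed.

Lemma measurable_stays_out k x : measurable (stays_out k x).
Proof. by rewrite stays_outE; exact: bigcapT_measurable. Qed.

(** The running minimum of the norm is adjoined to the position, so that staying outside the ball
    over a finite horizon can be read from the final state. *)
Let sstep (z : ('cV[R]_n.+1 * R) * E) : 'cV[R]_n.+1 * R :=
  ((z.2.1 *m z.1.1 + z.2.2)%R,
   Num.min z.1.2 (enorm (z.2.1 *m z.1.1 + z.2.2)%R)).

Let msstep : measurable_fun setT sstep.
Proof.
have m1 : measurable_fun setT (fun z : ('cV[R]_n.+1 * R) * E => z.2.1).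
  exact: measurableT_comp.
have m2 : measurable_fun setT (fun z : ('cV[R]_n.+1 * R) * E => z.2.2).
  exact: measurableT_comp.
have m3 : measurable_fun setT (fun z : ('cV[R]_n.+1 * R) * E => z.1.1).
  exact: measurableT_comp.
have m4 : measurable_fun setT (fun z : ('cV[R]_n.+1 * R) * E => z.1.2).
  exact: measurableT_comp.
have m5 := measurable_fun_addmx (measurable_fun_mulmx m1 m3) m2.
apply: measurable_fun_pair => //; apply: measurable_minr => //.
exact: measurable_fun_enorm.
Qed.

Let sstart (y : 'cV[R]_n.+1) : 'cV[R]_n.+1 * R := (y, enorm y).

Let msstart : measurable_fun setT sstart.
Proof. by apply: measurable_fun_pair => //; exact: measurable_fun_enorm. Qed.

Let spsi (z : 'cV[R]_n.+1 * R) : \bar R := ((K < z.2)%R%:R)%:E.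

Let mspsi : measurable_fun setT spsi.
Proof.
apply/measurable_EFinP.
rewrite [X in measurable_fun _ X](_ : _ =
    (\1_[set r : R | (K < r)%R] \o @snd 'cV[R]_n.+1 R)); last first.
  by apply/funext => z /=; rewrite (@indic_natr _ _ _ (K < z.2)%R).
apply: measurableT_comp => //; apply: measurable_indic.
rewrite [X in measurable X](_ : _ = `]K, +oo[%classic) //.
by apply/seteqP; split => r /=; rewrite in_itv/= andbT.
Qed.

Let spsi0 z : 0 <= spsi z.
Proof. by rewrite lee_fin. Qed.

Let srun_psi k N x w : (run xi sstep k N (sstart (X x k w)) w).1 = X x (k + N) w /\
  spsi (run xi sstep k N (sstart (X x k w)) w) = (\1_(stays_outN k N x) w)%:E.
Proof.
elim: N => [|N [ih1 ih2]].
  rewrite addn0 stays_outN0 /spsi /=; split => //.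
  by rewrite (@indic_natr _ _ _ (K < enorm (X x k w))%R).
rewrite runSr addnS /sstep /= ih1; split => //.
move: ih2; rewrite /spsi /= => -[ih2]; rewrite lt_min stays_outNS indicI /= -ih2.
rewrite -mulnb natrM; congr (_ * _)%:E.
by rewrite (@indic_natr _ _ _ (K < enorm (X x (k + N.+1)%N w))%R) addnS.
Qed.

Let kN N y := kernel_iter xi P sstep spsi N (sstart y).

Let kN0 N y : 0 <= kN N y.
Proof. exact: kernel_iter_ge0. Qed.

Let mkN N : measurable_fun setT (kN N).
Proof.
apply: (@measurableT_comp _ _ _ _ _ _ (kernel_iter xi P sstep spsi N)) => //.
by apply: measurable_kernel_iter => // j; exact: measurable_innovation.
Qed.

Let stays_outN_markov k N x (F : set T) : measurable (F : set (hist k)) ->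
  P (F `&` stays_outN k N x) = \int[P]_(w in F) kN N (X x k w).
Proof.
move=> mF.
have mF' : measurable F.
  by apply: (@history_measurable _ _ _ _ _ _ V0 xi _ _ k) => // j; exact: measurable_innovation.
rewrite setIC -integral_indic//.
transitivity (\int[P]_(w in F) spsi (run xi sstep k N (sstart (X x k w)) w)).
  by apply: eq_integral => w _; rewrite (srun_psi k N x w).2.
rewrite (@integral_run _ _ _ T _ _ V0 xi _ _ R P h_indep h_id h_V0_indep _ _ sstep msstep
    spsi mspsi spsi0 k N (fun w => sstart (X x k w)) F)//.
- by move=> j; exact: measurable_innovation.
- by apply: (measurableT_comp msstart); exact: history_affine_rec.
Qed.

Let kNE N y : kN N y = P (stays_outN 0 N y).
Proof.
rewrite -[stays_outN 0 N y]setTI (@stays_outN_markov 0 N y setT)//.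
transitivity (\int[P]_w cst (kN N y) w) => //.
rewrite integral_cst// -[LHS]mule1; congr (_ * _); exact/esym/probability_setT.
Qed.

Let stays_outN_cvg k x F : measurable F ->
  P (F `&` stays_outN k N x) @[N --> \oo] --> P (F `&` stays_out k x).
Proof.
move=> mF; rewrite stays_outE -bigcapIr//.
apply: (@nonincreasing_cvg_mu _ _ _ P (fun N => F `&` stays_outN k N x)).
- by apply: le_lt_trans (probability_le1 P _) (ltry _); exact: measurableI.
- by move=> N; exact: measurableI.
- by apply: bigcapT_measurable => N; exact: measurableI.
- apply/nonincreasing_seqP => N; apply/subsetPset; rewrite stays_outNS.
  by move=> w [Fw []].
Qed.

Let kN_cvg y : kN N y @[N --> \oo] --> P (stays_out 0 y).
Proof.
rewrite -[stays_out 0 y]setTI; under eq_fun do rewrite kNE -[stays_outN _ _ _]setTI.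
exact: stays_outN_cvg.
Qed.

Lemma measurable_stays_out_proba : measurable_fun setT (fun y => P (stays_out 0 y)).
Proof. by apply: (emeasurable_fun_cvg kN) => // y _; exact: kN_cvg. Qed.

(** The finite-horizon identity passes to the limit by continuity from above on the left and
    dominated convergence on the right. [V0] may enter [F], but not the integrand as a function of
    the position. *)
Lemma stays_out_markov k x (F : set T) : measurable (F : set (hist k)) ->
  P (F `&` stays_out k x) = \int[P]_(w in F) P (stays_out 0 (X x k w)).
Proof.
move=> mF.
have mF' : measurable F.
  by apply: (@history_measurable _ _ _ _ _ _ V0 xi _ _ k) => // j; exact: measurable_innovation.
apply: (cvg_unique _ (@stays_outN_cvg k x F mF')); first exact: ereal_hausdorff.
rewrite /=.
rewrite (_ : (fun N => _) = (fun N => \int[P]_(w in F) kN N (X x k w))); last first.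
  by apply/funext => N; exact: stays_outN_markov.
have h1 N : measurable_fun F (fun w => kN N (X x k w)).
  by apply: measurable_funTS; exact: measurableT_comp.
have h2 : measurable_fun F (fun w => P (stays_out 0 (X x k w))).
  apply: measurable_funTS.
  by apply: (@measurableT_comp _ _ _ _ _ _ (fun y => P (stays_out 0 y))) => //;
    exact: measurable_stays_out_proba.
have h3 : {ae P, forall w, F w -> kN N (X x k w) @[N --> \oo] --> P (stays_out 0 (X x k w))}.
  by apply/aeW => w _; exact: kN_cvg.
have h4 : P.-integrable F (cst 1).
  by apply: (@integrableS _ _ _ P setT) => //; exact: finite_measure_integrable_cst.
have h5 : {ae P, forall w (N : nat), F w -> `|kN N (X x k w)| <= cst 1 w}.
  by apply/aeW => w N _; rewrite gee0_abs// kNE probability_le1.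
by have [_ _] := dominated_convergence mF' h1 h2 h3 h4 h5.
Qed.

End survival.

(** * The length of a block as a stopping time *)

Section stopping.
Context {R : realType} {n : nat} {disp : measure_display} {T : measurableType disp}
  {P : probability T R}.
Variables (A : nat -> {RV P >-> 'M[R]_n.+1}) (B : nat -> {RV P >-> 'cV[R]_n.+1}).
Variable V0 : {RV P >-> projspace R n}.
Local Notation xi := (fun k w => (A k w, B k w)).
Local Notation hist := (history V0 xi).
Local Notation E := ('M[R]_n.+1 * 'cV[R]_n.+1)%type.
Variable rho : R.
Local Notation gain := (fun k w => pgain (mxprods A k w) (V0 w)).
Local Notation ell := (fun w => ell1 A rho (V0 w) w).

(** This event and the next are ell > k and ell = k, written with gains of index at most k so that
    they visibly belong to [history k]. *)
Definition not_stopped (k : nat) : set T :=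
  [set w | forall j, (0 < j <= k)%N -> rho < gain j w].

Definition stopped (k : nat) : set T :=
  [set w | [/\ (0 < k)%N, not_stopped k.-1 w & gain k w <= rho]].

Let history_gain k : measurable_fun setT (gain k : hist k -> R).
Proof. by apply: measurable_fun_pgain; [exact: history_mxprods|exact: history_V0]. Qed.

Lemma history_not_stopped k : measurable (not_stopped k : set (hist k)).
Proof.
elim: k => [|k ih].
  rewrite (_ : not_stopped 0 = setT); first exact: measurableT.
  by apply/seteqP; split => // w _ [].
rewrite (_ : not_stopped k.+1 =
    not_stopped k `&` (gain k.+1 : hist k.+1 -> R) @^-1` `]rho, +oo[).
  apply: (@measurableI _ (hist k.+1)); first exact: (history_le (leqnSn k)).
  by rewrite -[X in measurable X]setTI; exact: history_gain.
apply/seteqP; split => w /=.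
  move=> h; split; last by rewrite in_itv/= andbT; apply: (h k.+1); rewrite leqnn.
  by move=> j /andP[j0 jk]; apply: h; rewrite j0 leqW.
move=> [h1]; rewrite in_itv/= andbT => h2 j /andP[j0].
by rewrite leq_eqVlt => /orP[/eqP -> //|jk]; apply: h1; rewrite j0.
Qed.

Lemma history_stopped k : measurable (stopped k : set (hist k)).
Proof.
case: k => [|k].
  rewrite (_ : stopped 0 = set0); first exact: measurable0.
  by apply/seteqP; split => // w [].
rewrite (_ : stopped k.+1 =
    not_stopped k `&` (gain k.+1 : hist k.+1 -> R) @^-1` `]-oo, rho]).
  apply: (@measurableI _ (hist k.+1)); first by apply: (history_le (leqnSn k)); exact: history_not_stopped.
  by rewrite -[X in measurable X]setTI; exact: history_gain.
by apply/seteqP; split => w /=; rewrite in_itv/= => -[].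
Qed.

Lemma measurable_not_stopped k : measurable (not_stopped k).
Proof.
apply: (@history_measurable _ _ _ _ _ _ V0 xi _ _ k) => //.
  by move=> j; exact: measurable_innovation.
exact: history_not_stopped.
Qed.

Lemma measurable_stopped k : measurable (stopped k).
Proof.
apply: (@history_measurable _ _ _ _ _ _ V0 xi _ _ k) => //.
  by move=> j; exact: measurable_innovation.
exact: history_stopped.
Qed.

Lemma trivIset_stopped : trivIset setT stopped.
Proof.
have lt_stopped k l w : (k < l)%N -> stopped k w -> stopped l w -> False.
  move=> kl [k0 _ gk] [l0 nl _]; have := nl k; rewrite k0 -ltnS prednK// kl.
  by move=> /(_ isT); rewrite ltNge gk.
apply/trivIsetP => k l _ _; rewrite neq_ltn => kl; apply/seteqP; split => // w [wk wl].
by case/orP: kl => kl; [exact: (lt_stopped k l w)|exact: (lt_stopped l k w)].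
Qed.

Local Open Scope ereal_scope.

Lemma not_stopped_le_ell1 k w : not_stopped k w -> k.+1%:R%:E <= ell w.
Proof.
move=> h; apply: le_ereal_inf_tmp => _ [j /= [j1 jr] <-].
rewrite lee_fin ler_nat ltnNge; apply/negP => jk.
by have := h j; rewrite j1 jk => /(_ isT); rewrite ltNge jr.
Qed.

Lemma ell1_ge1 w : 1 <= ell w.
Proof. by apply: (@not_stopped_le_ell1 0) => -[]. Qed.

Lemma stopped_ell1 k w : stopped k w -> ell w = k%:R%:E.
Proof.
move=> [k0 nk gk]; apply/eqP; rewrite eq_le; apply/andP; split.
  by apply: ereal_inf_lbound; exists k.
by have := not_stopped_le_ell1 nk; rewrite prednK.
Qed.

Lemma ell1_lty_stopped w : ell w < +oo -> exists k, stopped k w.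
Proof.
move=> h; have [j [j1 jr]] : exists j, (0 < j)%N /\ (gain j w <= rho)%R.
  apply: contrapT => hN; move: h; rewrite [X in X < _](_ : _ = +oo) ?ltxx//.
  rewrite /ell1 (_ : [set k | _] = set0) ?image_set0 ?ereal_inf0//.
  by apply/seteqP; split => // j jh; apply: hN; exists j.
have ex : exists j, (0 < j)%N && (gain j w <= rho)%R by exists j; rewrite j1.
case: (ex_minnP ex) => m /andP[m0 mr] mmin; exists m; split => // i /andP[i0 im].
rewrite ltNge; apply/negP => ir; have := mmin i; rewrite i0 ir => /(_ isT).
by rewrite leqNgt -(prednK m0) ltnS im.
Qed.

Lemma measurable_ell1 : measurable_fun setT (fun w => ell w).
Proof.
pose u k w : \bar R := if (gain k w <= rho)%R then k%:R%:E else +oo.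
rewrite (_ : (fun _ => _) = fun w => einfs (u ^~ w) 1%N).
  apply: measurable_fun_einfs => k; apply: measurable_fun_ifT => //.
  apply: measurable_fun_ler => //.
  by apply: (@measurable_hist _ _ _ _ _ A B V0 k); exact: history_gain.
apply/funext => w; apply/eqP; rewrite eq_le; apply/andP; split.
  apply: le_ereal_inf_tmp => _ [k /= k1 <-]; rewrite /u; case: ifPn => [h|_]; last exact: leey.
  by apply: ereal_inf_lbound; exists k.
apply: le_ereal_inf_tmp => _ [k /= [k1 kr] <-].
by apply: ereal_inf_lbound; exists k => //; rewrite /u kr.
Qed.

End stopping.

(** * Translation parts along a block *)

Section moments.
Context {R : realType} {n : nat} {disp : measure_display} {T : measurableType disp}
  {P : probability T R}.
Variables (A : nat -> {RV P >-> 'M[R]_n.+1}) (B : nat -> {RV P >-> 'cV[R]_n.+1}).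
Variable V0 : {RV P >-> projspace R n}.
Local Notation xi := (fun k w => (A k w, B k w)).
Local Notation hist := (history V0 xi).
Local Notation E := ('M[R]_n.+1 * 'cV[R]_n.+1)%type.
Variable rho : R.
Local Notation ell := (fun w => ell1 A rho (V0 w) w).
Variable alpha : R.
Hypothesis alpha0 : 0 < alpha.

(** The counting bound [sum_indic_le] needs an exponent at most 1. The power [a^-1] that results is
    max(1 / alpha, 1), the lower bound imposed on gamma. *)
Let a := Num.min alpha 1.

Let a0 : 0 < a.
Proof. by rewrite lt_min alpha0 ltr01. Qed.

Let a1 : a <= 1.
Proof. by rewrite ge_min lexx orbT. Qed.

Let aalpha : a <= alpha.
Proof. by rewrite ge_min lexx. Qed.

Definition logp (e : 'cV[R]_n.+1) : R := Num.max (ln (enorm e)) 0.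

Lemma logp_ge0 e : 0 <= logp e.
Proof. by rewrite le_max lexx orbT. Qed.

Lemma enorm_le_expR_logp e : enorm e <= expR (logp e).
Proof.
have := enorm_ge0 e; rewrite le_eqVlt => /orP[/eqP <-|e0]; first exact: expR_ge0.
by rewrite -[leLHS]lnK ?posrE// ler_expR le_max lexx.
Qed.

Lemma measurable_logp : measurable_fun setT logp.
Proof.
apply: measurable_maxr => //; apply: (measurableT_comp (@measurable_ln R)).
exact: measurable_fun_enorm.
Qed.

(** Below the threshold (i + 1)^a the logarithm is absorbed by k^a for every k > i, so only the
    larger values are summed. *)
Definition large_logp (i : nat) (e : 'cV[R]_n.+1) : R :=
  logp e * (i.+1%:R `^ a < logp e)%R%:R.

Lemma large_logp_ge0 i e : 0 <= large_logp i e.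
Proof. by rewrite mulr_ge0 ?logp_ge0. Qed.

Lemma logp_le_large i e : logp e <= i.+1%:R `^ a + large_logp i e.
Proof.
rewrite /large_logp; case: (ltrP _ (logp e)) => h; last by rewrite mulr0 addr0.
by rewrite mulr1 lerDr powR_ge0.
Qed.

Lemma measurable_large_logp i : measurable_fun setT (large_logp i).
Proof.
apply: measurable_funM; first exact: measurable_logp.
rewrite (_ : (fun _ => _) = (\1_[set r : R | i.+1%:R `^ a < r] \o logp)); last first.
  by apply/funext => e /=; rewrite (@indic_natr _ _ _ (i.+1%:R `^ a < logp e)).
apply: measurableT_comp; last exact: measurable_logp.
apply: measurable_indic.
rewrite [X in measurable X](_ : _ = `]i.+1%:R `^ a, +oo[%classic) //.
by apply/seteqP; split => r /=; rewrite in_itv/= andbT.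
Qed.

Local Open Scope ereal_scope.

(** The sequence [e] is arbitrary because two choices occur: the actual translations [B i], and a
    constant sequence once each [B i] has been replaced by a copy of [B 0] independent of the
    block. *)
Definition logp_excess (w : T) (e : nat -> 'cV[R]_n.+1) : \bar R :=
  \sum_(i <oo) (\1_(not_stopped A V0 rho i) w * large_logp i (e i))%:E.

Let term_ge0 w (e : nat -> 'cV[R]_n.+1) i :
  0 <= (\1_(not_stopped A V0 rho i) w * large_logp i (e i))%:E.
Proof. by rewrite lee_fin mulr_ge0 ?large_logp_ge0// indicE. Qed.

Lemma logp_excess_ge0 w e : 0 <= logp_excess w e.
Proof. by apply: nneseries_ge0 => i _ _; exact: term_ge0. Qed.

Lemma logp_le_excess k i w (e : nat -> 'cV[R]_n.+1) : (i < k)%N ->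
  stopped A V0 rho k w ->
  (logp (e i))%:E <= (k%:R `^ a)%:E + logp_excess w e.
Proof.
move=> ik [k0 nk _].
have ni : not_stopped A V0 rho i w.
  by move=> j /andP[j0 ji]; apply: nk; rewrite j0 (leq_trans ji)// -ltnS prednK.
apply: (@le_trans _ _ ((i.+1%:R `^ a)%:E + (large_logp i (e i))%:E)).
  by rewrite -EFinD lee_fin logp_le_large.
apply: leeD.
  by rewrite lee_fin ge0_ler_powR ?nnegrE ?(ltW a0)// ler_nat.
apply: le_trans (le_nneseries_term i (term_ge0 w e)).
by rewrite indicE mem_set// mul1r.
Qed.

(* The number of indices i with (i + 1)^a < logp e and i + 1 <= l is at most
   min(l, y) <= l^a y^(1 - a), where y = (logp e)^(1/a) and a = min(alpha, 1). *)
Lemma logp_excess_le w (e : 'cV[R]_n.+1) :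
  logp_excess w (fun=> e) <= ell w `^ alpha * (logp e `^ a^-1)%:E.
Proof.
set y := (logp e `^ a^-1)%R.
have y0 : (0 <= y)%R by exact: powR_ge0.
have ya : (y `^ a = logp e)%R by rewrite -powRrM mulVf ?powRr1 ?logp_ge0// gt_eqF.
apply: nneseries_le => [i|N]; first exact: (term_ge0 w (fun=> e)).
have [[l l1 elE]|lE] : (exists2 l : R, (1 <= l)%R & ell w = l%:E) \/ ell w = +oo.
  have := ell1_ge1 A V0 rho w; case: (ell1 _ _ _ _) => [l||]//=; last by right.
  by move=> l1; left; exists l.
- rewrite elE poweR_EFin -EFinM sumEFin lee_fin.
  apply: (@le_trans _ _ (\sum_(0 <= i < N)
      ((i.+1%:R <= l) && (i.+1%:R < y))%:R * logp e)%R).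
    apply: ler_sum => i _; rewrite /large_logp mulrCA mulrC ler_wpM2r ?logp_ge0//.
    rewrite indicE; case: (boolP (w \in _)) => [/set_mem wi|_]; last by rewrite mul0r.
    case: (ltrP _ (logp e)) => iy; last by rewrite mulr0.
    have il := not_stopped_le_ell1 wi; rewrite elE lee_fin in il.
    rewrite il /= mulr1 (_ : (_ < y)%R = true)//.
    rewrite -(powRr1 (ler0n _ i.+1)) -[X in (_ `^ X)%R](@divff _ a) ?gt_eqF//.
    rewrite powRrM /y gt0_ltr_powR ?invr_gt0 ?nnegrE ?powR_ge0 ?logp_ge0//.
  rewrite -mulr_suml.
  apply: (@le_trans _ _ (l `^ a * y `^ (1 - a) * logp e)%R).
    by rewrite ler_wpM2r ?logp_ge0//; exact: sum_indic_le.
  rewrite -mulrA -ya -powRD; last first.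
    by rewrite subrK oner_eq0.
  by rewrite subrK powRr1// ler_wpM2r// ler_powR.
(* For an infinite ell the bound is infinite unless [logp e = 0], and then every term of the series
   vanishes. *)
- rewrite lE poweRyr ?gt_eqF//.
  have := y0; rewrite le_eqVlt => /orP[/eqP y0'|yp]; last first.
    by rewrite mulyr gtr0_sg// mul1e leey.
  rewrite -y0' mule0 big1// => i _; rewrite /large_logp -ya -y0' powR0 ?gt_eqF//.
  by rewrite mul0r mulr0.
Qed.

Hypotheses (h_indep : mutually_independent P xi) (h_id : identically_distributed P xi)
  (h_V0_indep : independent_of_sequence P V0 xi).

Lemma measurable_logp_excess :
  measurable_fun setT (fun w => logp_excess w (fun i => B i w)).
Proof.
apply: measurable_nneseries => [i w|i]; first exact: (term_ge0 w (fun i => B i w)).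
apply/measurable_EFinP.
apply: measurable_funM.
  by apply: measurable_indic; exact: measurable_not_stopped.
by apply: measurableT_comp => //; exact: measurable_large_logp.
Qed.

(** A Wald-type argument: [not_stopped i] lies in the past of [B i], so each term becomes a double
    integral over two independent copies, where [logp_excess_le] applies pointwise. *)
Lemma integral_logp_excess :
  \int[P]_w logp_excess w (fun i => B i w) <=
  (\int[P]_w (ell w `^ alpha)) * \int[P]_w (logp (B 0%N w) `^ a^-1)%:E.
Proof.
have mns i : measurable_fun setT (\1_(not_stopped A V0 rho i) : T -> R).
  by apply: measurable_indic; exact: measurable_not_stopped.
have mBi i j : measurable_fun setT (fun w => large_logp i (B j w)).
  by apply: measurableT_comp => //; exact: measurable_large_logp.
rewrite integral_nneseries//; last 2 first.
  by move=> i; apply/measurable_EFinP; exact: measurable_funM.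
  by move=> i w _; exact: (term_ge0 w (fun i => B i w)).
have step i : \int[P]_w (\1_(not_stopped A V0 rho i) w * large_logp i (B i w))%:E =
    \int[P]_w \int[P]_w' (\1_(not_stopped A V0 rho i) w * large_logp i (B 0%N w'))%:E.
  pose f (z : hist i * E) : \bar R :=
    (\1_(not_stopped A V0 rho i) z.1 * large_logp i z.2.2)%:E.
  rewrite -(@ge0_integral_history _ _ _ T _ _ V0 xi _ _ R P h_indep h_id h_V0_indep i f)//.
  - by move=> j; exact: measurable_innovation.
  - apply/measurable_EFinP; apply: measurable_funM.
      apply: (@measurableT_comp _ _ _ _ _ _ (\1_(not_stopped A V0 rho i) : hist i -> R)) => //.
      by apply: measurable_indic; exact: history_not_stopped.
    apply: (measurableT_comp (measurable_large_logp i)).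
    exact: measurableT_comp.
  - by move=> z; rewrite /f lee_fin mulr_ge0 ?large_logp_ge0// indicE.
under eq_eseriesr do rewrite step.
have mell : measurable_fun setT (fun w => ell w `^ alpha).
  apply: (@measurableT_comp _ _ _ _ _ _ (fun x : \bar R => x `^ alpha)).
    exact: measurable_poweR.
  exact: (measurable_ell1 A B).
have my : measurable_fun setT (fun w => (logp (B 0%N w) `^ a^-1)%:E).
  apply/measurable_EFinP.
  apply: (@measurableT_comp _ _ _ _ _ _ (fun x : R => x `^ a^-1)%R).
    exact: measurable_powR.
  by apply: measurableT_comp => //; exact: measurable_logp.
have fact i w : \int[P]_w' (\1_(not_stopped A V0 rho i) w * large_logp i (B 0%N w'))%:E =
    (\1_(not_stopped A V0 rho i) w)%:E * \int[P]_w' (large_logp i (B 0%N w'))%:E.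
  rewrite -ge0_integralZl//; first exact/measurable_EFinP.
  by move=> w' _; rewrite lee_fin large_logp_ge0.
rewrite -integral_nneseries//; last 2 first.
- move=> i; under eq_fun do rewrite fact.
  by apply: emeasurable_funM => //; exact/measurable_EFinP.
- move=> i w _; apply: integral_ge0 => w' _.
  exact: (term_ge0 w (fun=> B 0%N w')).
rewrite -ge0_integralZr//; last 2 first.
  by move=> w _; exact: poweR_ge0.
  by apply: integral_ge0 => w _; rewrite lee_fin powR_ge0.
apply: ge0_le_integral => //.
- move=> w _; apply: nneseries_ge0 => i _ _; apply: integral_ge0 => w' _.
  exact: (term_ge0 w (fun=> B 0%N w')).
- apply: measurable_nneseries => [i w|i].
    by apply: integral_ge0 => w' _; exact: (term_ge0 w (fun=> B 0%N w')).
  under eq_fun do rewrite fact.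
  by apply: emeasurable_funM => //; exact/measurable_EFinP.
- by apply: emeasurable_funM.
move=> w _; rewrite -integral_nneseries//; last 2 first.
- by move=> i; apply/measurable_EFinP; apply: measurable_funM.
- by move=> i w' _; exact: (term_ge0 w (fun=> B 0%N w')).
rewrite -ge0_integralZl//; last 2 first.
- by move=> w' _; rewrite lee_fin powR_ge0.
- exact: poweR_ge0.
apply: ge0_le_integral => //.
- by move=> w' _; exact: logp_excess_ge0 w (fun=> B 0%N w').
- apply: measurable_nneseries => [i w'|i]; first exact: (term_ge0 w (fun=> B 0%N w')).
  by apply/measurable_EFinP; apply: measurable_funM.
- exact: emeasurable_funM.
by move=> w' _; exact: logp_excess_le.
Qed.

End moments.

(** * Drift of the logarithm and recurrence *)

Section block_drift.
Context {R : realType} {n : nat} {disp : measure_display} {T : measurableType disp}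
  {P : probability T R}.
Variables (A : nat -> {RV P >-> 'M[R]_n.+1}) (B : nat -> {RV P >-> 'cV[R]_n.+1}).
Variable V0 : {RV P >-> projspace R n}.
Variables (alpha beta L K : R).
Hypotheses (alpha0 : 0 < alpha) (beta1 : 1 <= beta) (L0 : 0 <= L) (K0 : 0 < K).

(** In the coefficient [2 + alpha^-1], one unit comes from the matrix products, one from the
    translations, and [alpha^-1] from the number of summands. The term [1 + g 0] is [le_lne_moment]
    at t = 1. *)
Lemma ln_affine_rec_stopped (k : nat) (w : T) (x : 'cV[R]_n.+1) (g : nat -> R) (sg sb : R) :
  stopped A V0 (expR (- L)) k w -> K < enorm x ->
  (loggain beta (mxprods A k w) (V0 w) <= (g 0%N)%:E)%E ->
  (forall i, (0 < i < k)%N ->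
    (loggain beta (mxblock A i (k - i) w) (pwalk A V0 i w) <= (g i)%:E)%E) ->
  0 <= sg -> 0 <= sb ->
  (forall i, (0 < i < k)%N -> i%:R `^ (- (alpha * (beta - 1))) * g i <= sg) ->
  (forall i, (i < k)%N -> logp (B i w) <= k%:R `^ alpha + sb) ->
  ln (1 + enorm (affine_rec A B x k w)) + L <=
  ln (1 + enorm x) + (1 + g 0%N) +
  ln (1 + (1 + K)^-1 * expR ((2 + alpha^-1) * k%:R `^ alpha + sg + sb + 1 + L)).
Proof.
move=> [k0 nk gk] Kx hg0 hg sg0 sb0 hsg hsb.
have g00 : 0 <= g 0%N.
  by have := le_trans (poweR_ge0 _ _) hg0; rewrite lee_fin.
have ka0 : 0 <= k%:R `^ alpha by exact: powR_ge0.
have bound1 : opnorm (mxprods A k w) <= expR (1 + g 0%N) * expR (- L).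
  apply: (@le_trans _ _ (expR (1 + g 0%N) * pgain (mxprods A k w) (V0 w))).
    apply: eratio_le; rewrite ?opnorm_ge0 ?pgain_ge0//.
    by have := le_lne_moment ltr01 beta1 hg0; rewrite powR1 mulr1.
  by rewrite ler_wpM2l ?expR_ge0.
have bound2 i : (i < k)%N ->
    opnorm (mxblock A i.+1 (k - i.+1) w) <= expR (k%:R `^ alpha + sg).
  (* For the last translation the block is empty and its product is the identity; the bounds on [g]
     concern nonempty blocks only. *)
  rewrite leq_eqVlt => /orP[/eqP ik|ik].
    by rewrite ik subnn /mxblock /= opnorm1 -expR0 ler_expR addr_ge0.
  have i1 : 0 < i.+1%:R `^ alpha :> R by rewrite powR_gt0.
  have gi : expR (- L) < pgain (mxprods A i.+1 w) (V0 w).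
    by apply: nk; rewrite /= -ltnS prednK.
  have gi0 : 0 < pgain (mxprods A i.+1 w) (V0 w) by rewrite (lt_trans _ gi) ?expR_gt0.
  apply: (@le_trans _ _ (expR (k%:R `^ alpha + sg) *
      pgain (mxblock A i.+1 (k - i.+1) w) (pwalk A V0 i.+1 w))).
    apply: eratio_le; rewrite ?opnorm_ge0 ?pgain_ge0//.
    have hi := hg i.+1; rewrite ik in hi; have {}hi := hi isT.
    apply: (le_trans (le_lne_moment i1 beta1 hi)); rewrite lee_fin lerD//.
      by rewrite ge0_ler_powR ?nnegrE ?(ltW alpha0)// ler_nat ltnW.
    by rewrite -powRrM mulrN mulrC; apply: hsg; rewrite ik.
  rewrite -[leRHS]mulr1 ler_wpM2l ?expR_ge0// pgain_mxblock//.
  by rewrite ler_pdivrMr// mul1r subnKC 1?ltnW// (le_trans gk)// ltW.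
have bound3 i : (i < k)%N -> enorm (B i w) <= expR (k%:R `^ alpha + sb).
  by move=> ik; rewrite (le_trans (enorm_le_expR_logp _))// ler_expR hsb.
have := @enorm_stopped _ _ _ A B x k w _ _ _ _ bound1 bound2 bound3.
rewrite -expRD; apply: ln_stopped => //.
- by rewrite addr_ge0.
- apply: (@le_trans _ _ (expR (alpha^-1 * k%:R `^ alpha) *
      expR (k%:R `^ alpha + sg + (k%:R `^ alpha + sb)))).
    by rewrite ler_wpM2r ?expR_ge0//; exact: nat_le_expR.
  by rewrite -expRD ler_expR; lra.
- by rewrite !addr_ge0// mulr_ge0// addr_ge0// invr_ge0 ltW.
- exact: enorm_ge0.
Qed.

End block_drift.

Section integral_tools.
Context d (T : measurableType d) (R : realType) (P : probability T R).
Local Open Scope ereal_scope.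

Lemma integral_cst_probability (c : \bar R) : \int[P]_w c = c.
Proof.
have := integral_cst P measurableT c; rewrite /cst => ->.
by rewrite -[RHS]mule1; congr (_ * _); exact: probability_setT.
Qed.

Lemma integral_weighted_series (c : nat -> R) (C : R) (G : nat -> T -> \bar R) (I : \bar R) :
  (forall i, 0 <= c i)%R -> (forall N, \sum_(0 <= i < N) c i <= C)%R ->
  (forall i, measurable_fun setT (G i)) -> (forall i w, 0 <= G i w) ->
  (forall i, \int[P]_w G i w <= I) ->
  \int[P]_w (\sum_(i <oo) (c i)%:E * G i w) <= C%:E * I.
Proof.
move=> c0 cC mG G0 GI.
have I0 : 0 <= I by apply: le_trans (GI 0%N); exact: integral_ge0.
rewrite integral_nneseries//; last 2 first.
- by move=> i; apply: emeasurable_funM.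
- by move=> i w _; rewrite mule_ge0// lee_fin.
apply: nneseries_le => [i|N].
  by apply: integral_ge0 => w _; rewrite mule_ge0// lee_fin.
apply: (@le_trans _ _ (\sum_(0 <= i < N) (c i)%:E * I)).
  apply: lee_sum => i _; rewrite ge0_integralZl ?lee_fin// lee_wpmul2l ?lee_fin//.
rewrite -ge0_sume_distrl => [|i _]; last by rewrite lee_fin.
by rewrite sumEFin lee_wpmul2r// lee_fin.
Qed.

(** The integrand tends to 0 as K grows and is dominated by [fine (J w) + c + 1], because ln (1 +
    exp y) <= y + 1 for y >= 0. *)
Lemma integral_ln_small (J : T -> \bar R) (c : R) : measurable_fun setT J ->
  (forall w, 0 <= J w) -> \int[P]_w J w < +oo -> (0 <= c)%R ->
  exists2 K : R, (0 < K)%R &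
    \int[P]_w (ln (1 + (1 + K)^-1 * expR (fine (J w) + c)))%:E <= 1.
Proof.
move=> mJ J0 Joo c0.
pose f (N : nat) w := (ln (1 + (1 + N.+1%:R)^-1 * expR (fine (J w) + c)))%R.
have mfJ : measurable_fun setT (fun w => fine (J w)).
  by apply: (measurableT_comp (fine_measurable measurableT)).
have fJ0 w : (0 <= fine (J w))%R by exact: fine_ge0.
have N0 (N : nat) : (0 < (1 + N.+1%:R)^-1 :> R)%R by rewrite invr_gt0 ltr_pwDl.
have f0 N w : (0 <= f N w)%R.
  by rewrite ln_ge0// lerDl mulr_ge0 ?expR_ge0// ltW.
have mf N : measurable_fun setT (f N).
  apply: (measurableT_comp (@measurable_ln R)); apply: measurable_funD => //.
  apply: measurable_funM => //; apply: (measurableT_comp (@measurable_expR R)).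
  exact: measurable_funD.
have h1 N : measurable_fun setT (EFin \o f N) by apply/measurable_EFinP.
have h2 : measurable_fun setT (cst 0 : T -> \bar R) by exact: measurable_cst.
have h3 : {ae P, forall w, setT w -> (EFin \o f N) w @[N --> \oo] --> cst 0 w}.
  apply/aeW => w _ /=; apply: cvg_EFin; first exact: nearW.
  apply: (@squeeze_cvgr _ _ _ _ (cst 0%R) (fun N => N.+1%:R^-1 * expR (fine (J w) + c))%R).
  - apply: nearW => N; rewrite f0/=.
    apply: (@le_trans _ _ ((1 + N.+1%:R)^-1 * expR (fine (J w) + c))%R).
      by apply: le_ln1Dx; rewrite (lt_le_trans (ltrN10 R))// mulr_ge0 ?expR_ge0// ltW.
    by rewrite ler_wpM2r ?expR_ge0// lef_pV2 ?posrE ?ltr_pwDl// lerDr.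
  - exact: cvg_cst.
  - rewrite -[X in _ --> X](mul0r (expR (fine (J w) + c))); apply: cvgMl.
    exact: cvg_harmonic.
have mg : measurable_fun setT (fun w => (fine (J w) + c + 1)%:E).
  by apply/measurable_EFinP; apply: measurable_funD => //; exact: measurable_funD.
have h4 : P.-integrable setT (fun w => (fine (J w) + c + 1)%:E).
  apply/integrableP; split => //.
  apply: (@le_lt_trans _ _ (\int[P]_w (J w + (c + 1)%:E))).
    apply: ge0_le_integral => //.
    - exact: measurableT_comp.
    - exact: emeasurable_funD.
    move=> w _; rewrite gee0_abs; last by rewrite lee_fin !addr_ge0.
    rewrite -addrA EFinD leeD2r//; case: (J w) (J0 w) => // _; exact: leey.
  rewrite ge0_integralD//; last by move=> w _; rewrite lee_fin addr_ge0.
  by rewrite integral_cst_probability lte_add_pinfty// ltry.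
have h5 : {ae P, forall w (N : nat), setT w -> `|(EFin \o f N) w| <= (fine (J w) + c + 1)%:E}.
  apply/aeW => w N _ /=; rewrite lee_fin ger0_norm// /f.
  set y := (fine (J w) + c)%R.
  have y0 : (0 <= y)%R by rewrite addr_ge0.
  rewrite -[leRHS]expRK ler_ln ?posrE ?expR_gt0//.
  have e1 : (1 <= expR y)%R by rewrite -expR0 ler_expR.
  have e2 : (2 <= expR 1 :> R)%R by exact: expR_ge1Dx.
  have s1 : ((1 + N.+1%:R)^-1 <= 1 :> R)%R by rewrite invf_le1 ?lerDl// ltr_pwDl.
  apply: (@le_trans _ _ (expR y * 2)%R).
    by rewrite mulr_natr mulr2n lerD// ler_piMl// expR_ge0.
  by rewrite (expRD y 1) ler_wpM2l// expR_ge0.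
have [_ _] := dominated_convergence measurableT h1 h2 h3 h4 h5.
rewrite integral0 => /fine_cvgP[fin] /cvgr_le /(_ _ ltr01) le1.
have [N [/= Nfin N1]] := filter_ex (filterI fin le1).
by exists N.+1%:R => //; rewrite -[leLHS]fineK.
Qed.

End integral_tools.

(** * From the drift over one block to certain return *)

Section drift.
Context {R : realType} {n : nat} {disp : measure_display} {T : measurableType disp}
  {P : probability T R}.
Variables (A : nat -> {RV P >-> 'M[R]_n.+1}) (B : nat -> {RV P >-> 'cV[R]_n.+1}).
Variable V0 : {RV P >-> projspace R n}.
Local Notation xi := (fun k w => (A k w, B k w)).
Local Notation X := (affine_rec A B).
Local Open Scope ereal_scope.
Hypotheses (h_indep : mutually_independent P xi) (h_id : identically_distributed P xi)
  (h_V0_indep : independent_of_sequence P V0 xi).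
Variables (rho L K : R) (Q : T -> \bar R).
Hypotheses (L0 : (0 <= L)%R) (mQ : measurable_fun setT Q) (Q0 : forall w, 0 <= Q w).
Local Notation g x := (P (stays_out A B K 0 x)).
Local Notation U x := ((ln (1 + enorm x))%:E).

Hypothesis h_stop : {ae P, forall w, exists k, stopped A V0 rho k w}.
Hypothesis h_Q : \int[P]_w Q w + 1 <= L%:E.
Hypothesis h_drift : forall x, (K < enorm x)%R ->
  {ae P, forall w k, stopped A V0 rho k w -> U (X x k w) + L%:E <= U x + Q w}.

Let U0 (x : 'cV[R]_n.+1) : 0 <= U x.
Proof. by rewrite lee_fin ln_ge0// lerDl enorm_ge0. Qed.

Let D := \bigcup_k stopped A V0 rho k.

Let mS k : measurable (stopped A V0 rho k).
Proof. exact: (measurable_stopped A B). Qed.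

Let mD : measurable D.
Proof. exact: bigcupT_measurable. Qed.

Let PD : P D = 1.
Proof.
have [N [mN N0 DN]] := h_stop.
have mCD : measurable (~` D) by exact: measurableC.
have : P (~` D) = 0.
  apply/eqP; rewrite eq_le measure_ge0 andbT -N0; apply: le_measure; rewrite ?inE//.
  by move=> w /= nD; apply: DN => /= -[k wk]; apply: nD; exists k.
rewrite probability_setC// => h; apply/eqP; rewrite eq_le probability_le1//=.
by rewrite -sube_le0 h.
Qed.

Let PDI F : measurable F -> P (F `&` D) = P F.
Proof.
move=> mF; rewrite [RHS](@measureDI _ _ _ P F D)// [X in _ = X + _](_ : _ = 0) ?add0e//.
apply/eqP; rewrite eq_le measure_ge0 andbT.
apply: (@le_trans _ _ (P (~` D))); last by rewrite probability_setC// PD subee.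
apply: le_measure; rewrite ?inE; [exact: measurableD|exact: measurableC|by move=> w []].
Qed.

Let mg : measurable_fun setT (fun x => g x).
Proof. by apply: (@measurable_stays_out_proba _ _ _ _ _ _ _ V0). Qed.

Let mX x k : measurable_fun setT (X x k).
Proof. by apply: (@measurable_hist _ _ _ _ _ A B V0 k); exact: history_affine_rec. Qed.

Let mU x k : measurable_fun setT (fun w => U (X x k w)).
Proof.
apply/measurable_EFinP; apply: (measurableT_comp (@measurable_ln R)).
by apply: measurable_funD => //; exact: measurable_fun_enorm.
Qed.

(* Iterating the drift inequality along successive stopping times only needs
   the Markov property: no sequence of stopping times has to be built. *)
Lemma stays_out_drift (m : nat) x : m%:R%:E * g x <= U x.
Proof.
elim: m x => [|m ih] x; first by rewrite mul0e U0.
have mso k y : measurable (stays_out A B K k y) by apply: measurable_stays_out.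
(* Inside the ball g vanishes, since [stays_out] counts time 0; the drift is available only
   outside. *)
have [Kx|xK] := ltrP K (enorm x); last first.
  rewrite (_ : stays_out A B K 0 x = set0) ?measure0 ?mule0 ?U0//.
  by apply/seteqP; split => // w /(_ 0%N (leqnn _)); rewrite /= ltNge xK.
(* Passing from m to m + 1 costs at most 1 because g <= 1; [h_Q] provides exactly this unit. *)
suff : m%:R%:E * g x + L%:E + 1 <= U x + L%:E.
  rewrite addeAC leeD2rE// => h; apply: le_trans h.
  rewrite -natr1 EFinD ge0_muleDl ?lee_fin// mul1e leeD2l//.
  exact: probability_le1.
have key : \int[P]_(w in D) ((m%:R * \1_(stays_out A B K 0 x) w)%:E + L%:E) <=
    \int[P]_(w in D) (U x + Q w).
  have m1 : measurable_fun setT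
      (fun w => (m%:R * \1_(stays_out A B K 0 x) w)%:E : \bar R).
    by apply/measurable_EFinP; apply: measurable_funM => //; exact: measurable_indic.
  rewrite !ge0_integral_bigcup//; first last.
  - exact: trivIset_stopped.
  - by move=> w _; rewrite adde_ge0 ?lee_fin ?mulr_ge0// indicE.
  - by apply: measurable_funTS; exact: emeasurable_funD.
  - exact: trivIset_stopped.
  - by move=> w _; rewrite adde_ge0 ?U0.
  - by apply: measurable_funTS; exact: emeasurable_funD.
  apply: lee_nneseries => [k _ _|k _].
    by apply: integral_ge0 => w _; rewrite adde_ge0 ?lee_fin ?mulr_ge0// indicE.
  have mgX : measurable_fun setT (fun w => m%:R%:E * g (X x k w)).
    by apply: emeasurable_funM => //; exact: (measurableT_comp mg).
  (* On [stopped k], staying out forever implies staying out from time k on, which the Markov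
     property turns into g at X_k; the induction hypothesis then applies at X_k. *)
  apply: (@le_trans _ _
      (\int[P]_(w in stopped A V0 rho k) (m%:R%:E * g (X x k w) + L%:E))).
    rewrite !ge0_integralD//; first last.
    - exact: measurable_funTS.
    - exact: measurable_funTS.
    - by move=> w _; rewrite mule_ge0// lee_fin.
    rewrite leeD2r// ge0_integralZl//; last by apply: measurable_funTS; exact: (measurableT_comp mg).
    under eq_integral do rewrite EFinM.
    rewrite ge0_integralZl//; last first.
      by apply/measurable_EFinP; apply: measurable_funTS; exact: measurable_indic.
    rewrite lee_wpmul2l ?lee_fin// integral_indic//.
    have hS : measurable (stopped A V0 rho k : set (history V0 xi k)).
      exact: history_stopped.
    rewrite -(stays_out_markov h_indep h_id h_V0_indep K x hS).
    rewrite setIC; apply: le_measure; rewrite ?inE; [exact: measurableI|exact: measurableI|].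
    by move=> w [Sw so]; split => // j _; exact: so.
  apply: ae_ge0_le_integral => //.
  - by move=> w _; rewrite adde_ge0 ?lee_fin// mule_ge0// lee_fin.
  - by apply: measurable_funTS; exact: emeasurable_funD.
  - by move=> w _; rewrite adde_ge0.
  - by apply: measurable_funTS; exact: emeasurable_funD.
  apply: filterS (h_drift Kx) => w hw Sw.
  by apply: le_trans (hw k Sw); rewrite leeD2r.
have {}key : m%:R%:E * g x + L%:E <= U x + \int[P]_w Q w.
  apply: (@le_trans _ _ (\int[P]_(w in D) (U x + Q w))); last first.
    apply: (@le_trans _ _ (\int[P]_w (U x + Q w))).
      apply: ge0_subset_integral => //; first exact: emeasurable_funD.
      by move=> w _; rewrite adde_ge0.
    by rewrite ge0_integralD// integral_cst_probability.
  apply: le_trans key; rewrite ge0_integralD//; last first.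
    by apply/measurable_EFinP; apply: measurable_funM => //; apply: measurable_funTS.
  under [X in _ <= X + _]eq_integral do rewrite EFinM.
  rewrite ge0_integralZl//; last first.
    by apply/measurable_EFinP; apply: measurable_funTS; exact: measurable_indic.
  have -> : \int[P]_(w in D) (\1_(stays_out A B K 0 x) w)%:E = g x.
    by rewrite integral_indic//; exact: PDI.
  rewrite integral_cst// [X in _ <= _ + X](_ : _ = L%:E)//.
  by rewrite -[RHS]mule1; congr (_ * _); exact: PD.
rewrite (le_trans (leeD2r 1 key))// -addeA leeD2l//.
Qed.

(** A general k is needed for the lower limit; the Markov property at time k reduces it to k = 0. *)
Lemma stays_out_null k x : P (stays_out A B K k x) = 0.
Proof.
have g0 y : g y = 0.
  have gE : g y = (fine (g y))%:E.
    by rewrite fineK// fin_num_measure//; exact: (measurable_stays_out A B V0).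
  have [p0|p0] := leP (fine (g y)) 0%R.
    by apply/eqP; rewrite eq_le measure_ge0 andbT gE lee_fin.
  have u0 : (0 <= ln (1 + enorm y) / fine (g y))%R.
    by have := U0 y; rewrite lee_fin => Uy; rewrite divr_ge0// ltW.
  have := stays_out_drift (Num.bound (ln (1 + enorm y) / fine (g y))) y.
  by rewrite gE -EFinM lee_fin leNgt -ltr_pdivrMr// archi_boundP.
have mT : measurable (setT : set (history V0 xi k)) by exact: measurableT.
rewrite -[stays_out _ _ _ _ _]setTI (stays_out_markov h_indep h_id h_V0_indep K x mT).
by under eq_integral do rewrite g0; rewrite integral0.
Qed.

End drift.

Lemma liminf_of_stays_out_null (R : realType) (n : nat) (disp : measure_display)
    (T : measurableType disp) (P : probability T R)
    (A : nat -> {RV P >-> 'M[R]_n.+1}) (B : nat -> {RV P >-> 'cV[R]_n.+1})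
    (V0 : {RV P >-> projspace R n}) (K : R) (x : 'cV[R]_n.+1) :
  (forall k, P (stays_out A B K k x) = 0%E) ->
  P [set w | (limn_einf (fun k => (enorm (affine_rec A B x k w))%:E) <= K%:E)%E] = 1%E.
Proof.
move=> h0; set S := [set w | _].
have mu k : measurable_fun setT (fun w => (enorm (affine_rec A B x k w))%:E).
  apply/measurable_EFinP; apply: measurable_fun_enorm.
  by apply: (@measurable_hist _ _ _ _ _ A B V0 k); exact: history_affine_rec.
have SE w : S w <->
    (limn (einfs (fun k => (enorm (affine_rec A B x k w))%:E)) <= K%:E)%E.
  by rewrite /S /mkset limn_einf_lim.
have mS : measurable S.
  rewrite (_ : S = (fun w =>
      limn (einfs (fun k => (enorm (affine_rec A B x k w))%:E))) @^-1` `]-oo, K%:E]); last first.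
    by apply/seteqP; split => w; [move/SE|move=> h; apply/SE; move: h]; rewrite /= in_itv.
  rewrite -[X in measurable X]setTI.
  suff m : measurable_fun setT
      (fun w => limn (einfs (fun k => (enorm (affine_rec A B x k w))%:E))).
    by apply: m => //; exact: emeasurable_itv.
  apply: (emeasurable_fun_cvg
    (fun k w => einfs (fun k => (enorm (affine_rec A B x k w))%:E) k)) => [k|w _].
    exact: measurable_fun_einfs.
  exact: is_cvg_einfs.
(* A trajectory that visits the ball after every time has all its tail infima at most K. *)
have CS : ~` S `<=` \bigcup_k stays_out A B K k x.
  move=> w nS; apply: contrapT => nso; apply: nS.
  apply/SE; apply: lime_le; first exact: is_cvg_einfs.
  apply: nearW => k.
  have [j kj jK] : exists2 j, (k <= j)%N & enorm (affine_rec A B x j w) <= K.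
    apply: contrapT => nj; apply: nso; exists k => // j kj.
    by rewrite ltNge; apply/negP => jK; apply: nj; exists j.
  apply: (@le_trans _ _ (enorm (affine_rec A B x j w))%:E); last by rewrite lee_fin.
  by apply: ereal_inf_lbound; exists j.
have mso k : measurable (stays_out A B K k x) by apply: measurable_stays_out.
have PC : P (~` S) = 0%E.
  apply/(negligibleP P (measurableC mS)).
  apply: (negligibleS CS); apply: negligible_bigcup => k.
  by apply/(negligibleP P (mso k)); exact: h0.
rewrite -[S]setCK probability_setC; last exact: measurableC.
by rewrite PC sube0.
Qed.

Theorem mainTheorem3 (R : realType) (n : nat)
  (disp : measure_display) (T : measurableType disp) (P : probability T R)
  (A : nat -> {RV P >-> 'M[R]_n.+1}) (B : nat -> {RV P >-> 'cV[R]_n.+1})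
  (h_indep : mutually_independent P (fun k w => (A k w, B k w)))
  (h_id : identically_distributed P (fun k w => (A k w, B k w)))
  (h_A : (\int[P]_w lnep (opnorm (A 0%N w))%:E < +oo)%E)
  (h_lyap : lyapunov_exponent_is P A 0%E)
  (nu : probability (projspace R n) R)
  (h_inv : proj_invariant (distribution P (A 0%N)) nu)
  (V0 : {RV P >-> projspace R n})
  (h_V0 : forall U, measurable U -> distribution P V0 U = nu U)
  (h_V0_indep : independent_of_sequence P V0 (fun k w => (A k w, B k w)))
  (alpha beta gamma : R)
  (h_alpha : 0 < alpha)
  (h_beta : 1 + 1 / alpha < beta)
  (h_gamma : Num.max (1 / alpha) 1 <= gamma)
  (h_ell : forall rho : R, 0 < rho -> rho < 1 ->
     (\int[P]_w (ell1 A rho (V0 w) w `^ alpha) < +oo)%E)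
  (h_C : (\int[P]_w (lnep (C1 A (V0 w) w) `^ beta) < +oo)%E)
  (h_B : (\int[P]_w (lnep (enorm (B 0%N w))%:E `^ gamma) < +oo)%E) :
  exists2 K : R, 0 < K &
    forall x : 'cV[R]_n.+1,
      P [set w | (limn_einf (fun k => (enorm (affine_rec A B x k w))%:E)
                  <= K%:E)%E] = 1%E.
Proof.
have beta1 : 1 <= beta.
  by rewrite ltW// (lt_trans _ h_beta)// ltrDl divr_gt0.
have beta0 : 0 <= beta by rewrite (le_trans _ beta1).
set p := alpha * (beta - 1).
have p1 : 1 < p.
  by rewrite /p mulrC -ltr_pdivrMr// ltrBrDl.
have p0 : 0 < p by rewrite (lt_trans _ p1).
have [G [mG G0 GI GE]] := loggain_majorant h_indep h_id h_V0_indep h_inv h_V0 beta0.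
have G0oo : (\int[P]_w G 0%N w < +oo)%E by exact: le_lt_trans (GI 0%N) h_C.
have intG0 : (0 <= \int[P]_w G 0%N w)%E by exact: integral_ge0.
pose e0 := fine (\int[P]_w G 0%N w).
have e0E : (\int[P]_w G 0%N w = e0%:E)%E by rewrite fineK// ge0_fin_numE.
have e00 : 0 <= e0 by exact: fine_ge0.
(* The three units pay for the 1 in [1 + G 0], for the logarithmic error that K brings below 1 in
   mean, and for the net decrease. *)
pose L := e0 + 3.
have L0 : 0 <= L by rewrite addr_ge0.
pose rho := expR (- L).
have rho0 : 0 < rho by exact: expR_gt0.
have rho1 : rho < 1 by rewrite /rho -expR0 ltr_expR oppr_lt0 ltr_wpDl.
have ell_oo := h_ell rho rho0 rho1.
pose SG w := (\sum_(i <oo) (i.+1%:R `^ (- p))%:E * G i.+1 w)%E.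
have SG0 w : (0 <= SG w)%E.
  by apply: nneseries_ge0 => i _ _; rewrite mule_ge0// lee_fin powR_ge0.
have mSG : measurable_fun setT SG.
  apply: measurable_nneseries => [i w|i]; first by rewrite mule_ge0// lee_fin powR_ge0.
  exact: emeasurable_funM.
have SGoo : (\int[P]_w SG w < +oo)%E.
  apply: le_lt_trans (integral_weighted_series (c := fun i => i.+1%:R `^ (- p))
    (fun i => powR_ge0 _ _) (fun N => riemann_sum_le N p1) (fun i => mG i.+1)
    (fun i => G0 i.+1) (fun i => GI i.+1)) _.
  by rewrite lte_mul_pinfty// ?lee_fin ?divr_ge0 ?subr_ge0 ?ltW.
pose a := Num.min alpha 1.
have a0 : 0 < a by rewrite lt_min h_alpha ltr01.
have aV : a^-1 <= gamma.
  apply: le_trans h_gamma; rewrite le_max div1r /a.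
  by case: (leP alpha 1) => h; rewrite ?lexx ?invr1 ?lexx ?orbT.
pose SB w := logp_excess A V0 rho alpha w (fun i => B i w).
have SB0 w : (0 <= SB w)%E by exact: logp_excess_ge0.
have mSB : measurable_fun setT SB by exact: measurable_logp_excess.
have mlogp : measurable_fun setT (fun w => logp (B 0%N w)).
  by apply: measurableT_comp => //; exact: measurable_logp.
have logB_oo : (\int[P]_w (logp (B 0%N w) `^ a^-1)%:E < +oo)%E.
  apply: (@le_lt_trans _ _ (\int[P]_w (1 + lnep (enorm (B 0%N w))%:E `^ gamma))%E).
    apply: ge0_le_integral => //.
    - by move=> w _; rewrite lee_fin powR_ge0.
    - apply/measurable_EFinP.
      apply: (@measurableT_comp _ _ _ _ _ _ (fun x : R => x `^ a^-1)).
        exact: measurable_powR.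
      exact: mlogp.
    - apply: emeasurable_funD => //.
      apply: (@measurableT_comp _ _ _ _ _ _ (fun x : \bar R => x `^ gamma)%E).
        exact: measurable_poweR.
      apply: (measurableT_comp measurable_lnep); apply/measurable_EFinP.
      exact: measurable_fun_enorm.
    move=> w _; rewrite lnep_EFin poweR_EFin -EFinD lee_fin -/(logp (B 0%N w)).
    have [l1|l1] := leP 1 (logp (B 0%N w)).
      by rewrite (le_trans (ler_powR l1 aV))// lerDr.
    rewrite (@le_trans _ _ 1)// ?lerDl ?powR_ge0//.
    apply: (@le_trans _ _ (1 `^ a^-1)); last by rewrite powR1.
    by rewrite ge0_ler_powR ?nnegrE ?logp_ge0 ?invr_ge0 ?(ltW a0)// ltW.
  rewrite ge0_integralD//.
  - by rewrite integral_cst_probability lte_add_pinfty// ltry.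
  - by move=> w _; exact: poweR_ge0.
  - apply: (@measurableT_comp _ _ _ _ _ _ (fun x : \bar R => x `^ gamma)%E).
      exact: measurable_poweR.
    apply: (measurableT_comp measurable_lnep); apply/measurable_EFinP.
    exact: measurable_fun_enorm.
have SBoo : (\int[P]_w SB w < +oo)%E.
  apply: le_lt_trans (integral_logp_excess rho h_alpha h_indep h_id h_V0_indep) _.
  by apply: lte_mul_pinfty => //; rewrite ?ge0_fin_numE//; apply: integral_ge0 => w _;
    exact: poweR_ge0.
have mell : measurable_fun setT (fun w => ell1 A rho (V0 w) w `^ alpha)%E.
  apply: (@measurableT_comp _ _ _ _ _ _ (fun x : \bar R => x `^ alpha)%E).
    exact: measurable_poweR.
  exact: (measurable_ell1 A B).
have c0 : 0 <= 2 + alpha^-1 by rewrite addr_ge0// invr_ge0 ltW.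
pose J w := ((2 + alpha^-1)%:E * ell1 A rho (V0 w) w `^ alpha + SG w + SB w)%E.
have mJ : measurable_fun setT J.
  by apply: emeasurable_funD => //; apply: emeasurable_funD => //; exact: emeasurable_funM.
have J1_ge0 w : (0 <= (2 + alpha^-1)%:E * ell1 A rho (V0 w) w `^ alpha)%E.
  by rewrite mule_ge0 ?poweR_ge0// lee_fin.
have J0 w : (0 <= J w)%E by rewrite !adde_ge0.
have Joo : (\int[P]_w J w < +oo)%E.
  rewrite ge0_integralD//; last 2 first.
  - by move=> w _; rewrite adde_ge0.
  - by apply: emeasurable_funD => //; exact: emeasurable_funM.
  rewrite ge0_integralD//; last exact: emeasurable_funM.
  rewrite ge0_integralZl ?lee_fin//; last by move=> w _; exact: poweR_ge0.
  apply: lte_add_pinfty => //; apply: lte_add_pinfty => //.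
  by apply: lte_mul_pinfty => //; rewrite lee_fin.
(* [J] involves neither the starting point nor the number of steps, so K is uniform in x. *)
have [K K0 KJ] := @integral_ln_small _ _ _ P J (1 + L) mJ J0 Joo (addr_ge0 ler01 L0).
exists K => // x.
apply: (@liminf_of_stays_out_null _ _ _ _ _ A B V0) => k.
pose Q w := (1 + G 0%N w + (ln (1 + (1 + K)^-1 * expR (fine (J w) + (1 + L))))%:E)%E.
have lnJ0 w : 0 <= ln (1 + (1 + K)^-1 * expR (fine (J w) + (1 + L))).
  by rewrite ln_ge0// lerDl mulr_ge0 ?expR_ge0// invr_ge0 addr_ge0// ltW.
have mlnJ : measurable_fun setT
    (fun w => (ln (1 + (1 + K)^-1 * expR (fine (J w) + (1 + L))))%:E).
  apply/measurable_EFinP; apply: (measurableT_comp (@measurable_ln R)).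
  apply: measurable_funD => //; apply: measurable_funM => //.
  apply: (measurableT_comp (@measurable_expR R)); apply: measurable_funD => //.
  exact: (measurableT_comp (fine_measurable measurableT)).
apply: (@stays_out_null _ _ _ _ _ A B V0 h_indep h_id h_V0_indep rho L K Q) => //.
- by apply: emeasurable_funD => //; exact: emeasurable_funD.
- by move=> w; rewrite !adde_ge0// lee_fin.
(* The finite moment of ell makes it almost surely finite, so almost every block ends. *)
- have : P.-integrable setT (fun w => ell1 A rho (V0 w) w `^ alpha)%E.
    apply/integrableP; split => //.
    by under eq_integral do rewrite gee0_abs ?poweR_ge0//.
  move=> /(integrable_ae measurableT); apply: filterS => w /(_ Logic.I) h.
  apply: ell1_lty_stopped; apply: (@lty_poweRy _ _ alpha); first by rewrite gt_eqF.
  by rewrite -ge0_fin_numE// poweR_ge0.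
- have m1G : measurable_fun setT (fun w => 1 + G 0%N w)%E by exact: emeasurable_funD.
  have G1 w : (0 <= 1 + G 0%N w)%E by rewrite adde_ge0.
  rewrite ge0_integralD//; last by move=> w _; rewrite lee_fin.
  rewrite ge0_integralD// integral_cst_probability e0E.
  apply: (@le_trans _ _ (1 + e0%:E + 1 + 1)%E).
    by rewrite leeD2r// leeD2l.
  by rewrite -!EFinD lee_fin (_ : 1 + e0 + 1 + 1 = L)// /L; ring.
move=> y Ky.
have : P.-integrable setT J.
  apply/integrableP; split => //.
  by under eq_integral do rewrite gee0_abs//.
move=> /(integrable_ae measurableT); apply: filterS => w /(_ Logic.I) Jfin {}k wk.
have := Jfin; rewrite /J !fin_numD => /andP[/andP[_ SGfin] SBfin].
have ellE := stopped_ell1 wk.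
have JE : fine (J w) = (2 + alpha^-1) * k%:R `^ alpha + fine (SG w) + fine (SB w).
  by rewrite /J ellE poweR_EFin !fineD// ?fin_numD ?SGfin//.
(* Where [G 0] is infinite so is [Q], and there is nothing to prove; the other [G i] are finite
   wherever the series [SG] is. *)
have [G0fin|G0inf] := boolP (G 0%N w \is a fin_num); last first.
  rewrite /Q (_ : G 0%N w = +oo%E); last first.
    by move: G0inf; rewrite ge0_fin_numE// -leNgt leye_eq => /eqP.
  exact: leey.
pose g i := fine (G i w).
have g0E : G 0%N w = (g 0%N)%:E by rewrite fineK.
have k0 : (0 < k)%N by case: wk.
have k1 : 1 <= k%:R :> R by rewrite ler1n.
have SGterm i : (0 < i)%N -> ((i%:R `^ (- p))%:E * G i w <= SG w)%E.
  case: i => // i _.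
  apply: (le_nneseries_term (u := fun i => (i.+1%:R `^ (- p))%:E * G i.+1 w)%E) => j.
  by rewrite mule_ge0// lee_fin powR_ge0.
have gE i : (0 < i)%N -> G i w = (g i)%:E.
  move=> i0; rewrite fineK// ge0_fin_numE// ltey; apply/eqP => Gi.
  have := SGterm i i0; rewrite Gi gt0_muley ?lte_fin ?powR_gt0 ?ltr0n// leye_eq => /eqP h.
  by rewrite h in SGfin.
rewrite /Q JE g0E -!EFinD lee_fin addrA addrA.
have := @ln_affine_rec_stopped _ _ _ _ _ A B V0 alpha beta L K h_alpha beta1 L0 K0
  k w y g (fine (SG w)) (fine (SB w)) wk Ky.
rewrite !addrA; apply.
- by rewrite -g0E -mxblock0; exact: (GE 0%N k w k0).
- move=> i /andP[i0 ik]; rewrite -gE//; apply: GE.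
  by rewrite subn_gt0.
- exact: fine_ge0.
- exact: fine_ge0.
- move=> i /andP[i0 ik]; rewrite -lee_fin EFinM -gE// fineK//.
  exact: SGterm.
- move=> i ik; rewrite -lee_fin EFinD fineK//.
  apply: le_trans (logp_le_excess h_alpha (fun i => B i w) ik wk) _.
  by rewrite leeD2r// lee_fin ler_powR// ge_min lexx.
Qed.
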